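(* Let $R=\mathbb C[x_1,\ldots,x_n]$ be a polynomial ring and let $I\subset R$ be a normal zero-dimensional ideal, primary to $(x_1,\ldots,x_n)$. Then $$\nu_I=\sum_v v(I),$$ where $v$ ranges over the Rees valuations of $I$.
   Context: $I$ is normal if all powers $I^j$, $j\ge1$, are integrally closed. $\nu_I$ is the value at the unique closed point of the Behrend function of $X=\operatorname{Spec}(R/I)$. With $G=\operatorname{gr}_I(R)=\bigoplus_{j\ge0}I^j/I^{j+1}$ and $A=R/I$, Behrend's formula is $\nu_X=\sum_{\mathfrak P}(-1)^{\dim(A/\mathfrak P\cap A)}\lambda(G_{\mathfrak P})\operatorname{Eu}([\mathfrak P\cap A])$, sum over the minimal primes of $G$, with $\lambda$ length and $\operatorname{Eu}$ MacPherson's local Euler obstruction; for zero-dimensional $I$ this reads $\nu_I=\sum_{\mathfrak P}\lambda(G_{\mathfrak P})$, which may be taken as the definition of $\nu_I$. Let $\mathcal R=R[It]\subset R[t]$ be the Rees ring and $\overline{\mathcal R}=\bigoplus_{j\ge0}\overline{I^j}t^j$ its integral closure. The Rees valuations of $I$ are the normalized valuations of the discrete valuation rings $\overline{\mathcal R}_{\mathfrak Q}$, $\mathfrak Q$ ranging over the minimal primes of $I\overline{\mathcal R}$; $v(I)=\min\{v(f):f\in I\}$. *)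

(* Defs.v *)
From HB Require Import structures.
From mathcomp Require Import all_boot all_order all_algebra.
From mathcomp Require Import all_classical reals ereal esum.
From mathcomp Require Import complex ring.
From mathcomp Require Import -(notations) mpoly.

Set Implicit Arguments.
Unset Strict Implicit.
Unset Printing Implicit Defensive.

Import Order.TTheory GRing.Theory Num.Theory.
Local Open Scope quotient_scope.
Local Open Scope classical_set_scope.
Local Open Scope ring_scope.

Section Ideals.
Variable A : comNzRingType.
Implicit Types (I J K L X : set A).

Definition is_ideal J : Prop :=
  [/\ J 0, forall x y, J x -> J y -> J (x + y) & forall a x, J x -> J (a * x)].

Definition ideal_span X : set A :=
  [set x | forall J, is_ideal J -> X `<=` J -> J x].

Definition ideal_mul I J : set A := ideal_span [set x * y | x in I & y in J].

Definition ideal_exp I (j : nat) : set A := iter j (ideal_mul I) setT.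

(* The equation of integral dependence x^m + a_1 x^(m-1) + ... + a_m = 0. *)
Definition integral_closure J : set A :=
  [set x | exists m (a : nat -> A),
     [/\ (0 < m)%N, forall i, (1 <= i <= m)%N -> ideal_exp J i (a i)
       & x ^+ m + \sum_(1 <= i < m.+1) a i * x ^+ (m - i) = 0]].

Definition integrally_closed J : Prop := integral_closure J = J.

Definition normal_ideal I : Prop :=
  forall j, (1 <= j)%N -> integrally_closed (ideal_exp I j).

Record prime_ideal := PrimeIdeal {
  prime_set :> set A;
  prime_is_ideal : is_ideal prime_set;
  prime_proper : ~ prime_set 1;
  prime_mulP : forall x y, prime_set (x * y) -> prime_set x \/ prime_set y
}.

Definition radical I : set A := [set x | exists m, I (x ^+ m)].

Definition primary I : Prop :=
  [/\ is_ideal I, ~ I 1 & forall x y, I (x * y) -> I x \/ radical I y].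

Definition primary_to I M : Prop := primary I /\ radical I = M.

(* A / I has Krull dimension 0: there is a prime ideal over I, but no strict
   inclusion between two of them. *)
Definition zero_dimensional_ideal I : Prop :=
  (exists P : prime_ideal, I `<=` P) /\
  ~ (exists P Q : prime_ideal, I `<=` P /\ P `<` Q).

Definition minimal_prime_over I (P : prime_ideal) : Prop :=
  I `<=` P /\ forall Q : prime_ideal, I `<=` Q -> Q `<=` P -> Q = P :> set A.

(* The supremum of the lengths of chains J_0 < J_1 < ... < J_k of ideals, that
   is, the length of A as an A-module. *)
Definition ring_length (R : realType) : \bar R :=
  ereal_sup [set k%:R%:E | k in [set k : nat | exists J : nat -> set A,
    (forall i, (i <= k)%N -> is_ideal (J i)) /\
    (forall i, (i < k)%N -> J i `<` J i.+1)]].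

Lemma ideal_sum J (T : Type) (r : seq T) (p : pred T) (f : T -> A) :
  is_ideal J -> (forall i, p i -> J (f i)) -> J (\sum_(i <- r | p i) f i).
Proof. by case=> J0 JD _ Jf; apply: (big_ind J). Qed.

Lemma idealN J x : is_ideal J -> J x -> J (- x).
Proof. by case=> _ _ JM Jx; rewrite -mulN1r; apply: JM. Qed.

Lemma idealB J x y : is_ideal J -> J x -> J y -> J (x - y).
Proof. by move=> iJ Jx /(idealN iJ); case: iJ => _ JD _; apply: JD. Qed.

Lemma setT_ideal : is_ideal setT. Proof. by split. Qed.

Lemma span_ideal X : is_ideal (ideal_span X).
Proof.
split=> [J []//|x y Sx Sy J iJ XJ|a x Sx J iJ XJ].
  by case: (iJ) => _ JD _; apply: JD; [apply: Sx|apply: Sy].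
by case: (iJ) => _ _ JM; apply: JM; apply: Sx.
Qed.

Lemma ideal_mul_mem I J x y : I x -> J y -> ideal_mul I J (x * y).
Proof. by move=> Ix Jy K _; apply; exists x => //; exists y. Qed.

Lemma ideal_mul_sub I J K : is_ideal K ->
  (forall x y, I x -> J y -> K (x * y)) -> ideal_mul I J `<=` K.
Proof. by move=> iK IJK z; apply=> // _ [x Ix [y Jy <-]]; apply: IJK. Qed.

Lemma colon_ideal K L : is_ideal L -> is_ideal [set z | forall k, K k -> L (z * k)].
Proof.
case=> L0 LD LM; split=> [k _|x y Lx Ly k Kk|a x Lx k Kk] /=.
- by rewrite mul0r.
- by rewrite mulrDl; apply: LD; [apply: Lx|apply: Ly].
- by rewrite -mulrA; apply: LM; apply: Lx.
Qed.

Lemma ideal_mulC I J : ideal_mul I J = ideal_mul J I.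
Proof.
by apply/seteqP; split; apply: ideal_mul_sub (span_ideal _) _ => x y ? ?;
  rewrite mulrC; apply: ideal_mul_mem.
Qed.

Lemma ideal_mulA_sub I J K :
  ideal_mul (ideal_mul I J) K `<=` ideal_mul I (ideal_mul J K).
Proof.
apply: ideal_mul_sub (span_ideal _) _ => x y IJx Ky.
suff /(_ x IJx y Ky): ideal_mul I J `<=`
  [set z | forall k, K k -> ideal_mul I (ideal_mul J K) (z * k)] by [].
apply: ideal_mul_sub (colon_ideal _ (span_ideal _)) _ => a b Ia Jb k Kk /=.
by rewrite -mulrA; do 2?apply: ideal_mul_mem.
Qed.

Lemma ideal_mulA I J K :
  ideal_mul I (ideal_mul J K) = ideal_mul (ideal_mul I J) K.
Proof.
apply/seteqP; split; last exact: ideal_mulA_sub.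
rewrite ideal_mulC (ideal_mulC J) (ideal_mulC _ K) (ideal_mulC I J).
exact: ideal_mulA_sub.
Qed.

Lemma ideal_mul1 J : is_ideal J -> ideal_mul setT J = J.
Proof.
move=> iJ; apply/seteqP; split=> [|x Jx].
  by apply: ideal_mul_sub => // x y _ Jy; case: iJ => _ _; apply.
by rewrite -[x]mul1r; apply: ideal_mul_mem.
Qed.

Lemma ideal_expS I j : ideal_exp I j.+1 = ideal_mul I (ideal_exp I j).
Proof. by []. Qed.

Lemma exp_ideal I j : is_ideal (ideal_exp I j).
Proof. by case: j => [|j]; [apply: setT_ideal | apply: span_ideal]. Qed.

Lemma ideal_expD I i j :
  ideal_exp I (i + j) = ideal_mul (ideal_exp I i) (ideal_exp I j).
Proof.
elim: i => [|i IHi]; first by rewrite ideal_mul1 //; apply: exp_ideal.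
by rewrite addSn !ideal_expS IHi ideal_mulA.
Qed.

Lemma ideal_expM I i j : ideal_exp (ideal_exp I j) i = ideal_exp I (i * j).
Proof.
by elim: i => // i IHi; rewrite mulSn ideal_expD -IHi ideal_expS.
Qed.

Lemma ideal_exp_mulr I i j x y :
  ideal_exp I i x -> ideal_exp I j y -> ideal_exp I (i + j) (x * y).
Proof. by move=> Ix Iy; rewrite ideal_expD; apply: ideal_mul_mem. Qed.

End Ideals.

(* The localization of A at a prime ideal P, consisting of fractions a / s with
   s outside P, where a / s = b / t iff u (a t - b s) = 0 for some u outside P. *)
Module Localization.
Section Localization.
Variables (A : comNzRingType) (p : prime_ideal A).
Local Notation P := (prime_set p).

Lemma prime1 : 1 \notin P.
Proof. by rewrite notin_setE; apply: prime_proper. Qed.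

Lemma primeM s t : s \notin P -> t \notin P -> s * t \notin P.
Proof. by rewrite !notin_setE => Ps Pt /prime_mulP[]. Qed.

Record fracs := Fracs { fval :> A * A; fvalP : fval.2 \notin P }.
#[export] HB.instance Definition _ := [isSub for fval].
#[export] HB.instance Definition _ := [Choice of fracs by <:].

Definition equiv (x y : fracs) : bool :=
  `[< exists2 u, u \notin P & u * (x.1 * y.2 - y.1 * x.2) = 0 >].

Lemma equiv_is_equiv : equiv_class_of equiv.
Proof.
split=> [x|x y|y x z].
- by apply/asboolP; exists 1; rewrite ?prime1 // subrr mulr0.
- by apply/asboolP/asboolP => -[u Pu e]; exists u;
    rewrite // -opprB mulrN e oppr0.
- move=> /asboolP[u Pu e] /asboolP[w Pw e']; apply/asboolP.
  exists (u * w * y.2); first by rewrite !primeM // fvalP.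
  transitivity (w * z.2 * (u * (x.1 * y.2 - y.1 * x.2))
              + u * x.2 * (w * (y.1 * z.2 - z.1 * y.2))); first by ring.
  by rewrite e e' !mulr0 addr0.
Qed.

Canonical equiv_equiv := EquivRelPack equiv_is_equiv.
Canonical equiv_encModRel := defaultEncModRel equiv.

Definition type := {eq_quot equiv}.
#[export] HB.instance Definition _ : EqQuotient _ equiv type := EqQuotient.on type.
#[export] HB.instance Definition _ := Choice.on type.

Lemma equivP (x y : fracs) :
  reflect (exists2 u, u \notin P & u * (x.1 * y.2 - y.1 * x.2) = 0)
          (x == y %[mod type]).
Proof. by rewrite piE; apply: asboolP. Qed.

Lemma eqmod_repr (x : fracs) :
  exists2 u, u \notin P & u * ((repr (\pi_type x)).1 * x.2
                              - x.1 * (repr (\pi_type x)).2) = 0.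
Proof. by apply/equivP; rewrite reprK. Qed.

Definition frac0 : fracs := Fracs (fval := (0, 1)) prime1.
Definition frac1 : fracs := Fracs (fval := (1, 1)) prime1.
Definition fracN (x : fracs) : fracs :=
  Fracs (fval := (- x.1, x.2)) (fvalP x).
Definition fracD (x y : fracs) : fracs :=
  Fracs (fval := (x.1 * y.2 + y.1 * x.2, x.2 * y.2)) (primeM (fvalP x) (fvalP y)).
Definition fracM (x y : fracs) : fracs :=
  Fracs (fval := (x.1 * y.1, x.2 * y.2)) (primeM (fvalP x) (fvalP y)).

Definition zero : type := lift_cst type frac0.
Definition one : type := lift_cst type frac1.
Definition opp := lift_op1 type fracN.
Definition add := lift_op2 type fracD.
Definition mul := lift_op2 type fracM.

Canonical pi_zero_morph := PiConst zero.
Canonical pi_one_morph := PiConst one.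

Lemma pi_opp : {morph \pi : x / fracN x >-> opp x}.
Proof.
move=> x; unlock opp; apply/esym/eqP/equivP.
have [u Pu e] := eqmod_repr x; exists u => //=.
by rewrite !mulNr -opprD mulrN e oppr0.
Qed.
Canonical pi_opp_morph := PiMorph1 pi_opp.

Lemma pi_add : {morph \pi : x y / fracD x y >-> add x y}.
Proof.
move=> x y; unlock add; apply/esym/eqP/equivP.
have [u Pu e] := eqmod_repr x; have [w Pw e'] := eqmod_repr y.
exists (u * w); first exact: primeM; rewrite /=.
move: (repr (\pi x)) (repr (\pi y)) e e' => x' y' e e'.
transitivity (w * y.2 * y'.2 * (u * (x'.1 * x.2 - x.1 * x'.2))
            + u * x.2 * x'.2 * (w * (y'.1 * y.2 - y.1 * y'.2))); first by ring.
by rewrite e e' !mulr0 addr0.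
Qed.
Canonical pi_add_morph := PiMorph2 pi_add.

Lemma pi_mul : {morph \pi : x y / fracM x y >-> mul x y}.
Proof.
move=> x y; unlock mul; apply/esym/eqP/equivP.
have [u Pu e] := eqmod_repr x; have [w Pw e'] := eqmod_repr y.
exists (u * w); first exact: primeM; rewrite /=.
move: (repr (\pi x)) (repr (\pi y)) e e' => x' y' e e'.
transitivity (w * y'.1 * y.2 * (u * (x'.1 * x.2 - x.1 * x'.2))
            + u * x.1 * x'.2 * (w * (y'.1 * y.2 - y.1 * y'.2))); first by ring.
by rewrite e e' !mulr0 addr0.
Qed.
Canonical pi_mul_morph := PiMorph2 pi_mul.

Lemma eqmod (x y : fracs) : x.1 * y.2 = y.1 * x.2 -> x = y %[mod type].
Proof. by move=> e; apply/eqP/equivP; exists 1; rewrite ?prime1 // e subrr mulr0. Qed.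

Lemma addA : associative add.
Proof.
by elim/quotW=> x; elim/quotW=> y; elim/quotW=> z; rewrite !piE; apply: eqmod => /=; ring.
Qed.

Lemma addC : commutative add.
Proof.
by elim/quotW=> x; elim/quotW=> y; rewrite !piE; apply: eqmod => /=; ring.
Qed.

Lemma add0 : left_id zero add.
Proof. by elim/quotW=> x; rewrite !piE; apply: eqmod => /=; ring. Qed.

Lemma addN : left_inverse zero opp add.
Proof. by elim/quotW=> x; rewrite !piE; apply: eqmod => /=; ring. Qed.

#[export] HB.instance Definition _ := GRing.isZmodule.Build type addA addC add0 addN.

Lemma mulA : associative mul.
Proof.
by elim/quotW=> x; elim/quotW=> y; elim/quotW=> z; rewrite !piE; apply: eqmod => /=; ring.
Qed.

Lemma mulC : commutative mul.
Proof.
by elim/quotW=> x; elim/quotW=> y; rewrite !piE; apply: eqmod => /=; ring.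
Qed.

Lemma mul1 : left_id one mul.
Proof. by elim/quotW=> x; rewrite !piE; apply: eqmod => /=; ring. Qed.

Lemma mulD : left_distributive mul add.
Proof.
by elim/quotW=> x; elim/quotW=> y; elim/quotW=> z; rewrite !piE; apply: eqmod => /=; ring.
Qed.

Lemma one_neq0 : one != zero.
Proof.
rewrite !piE; apply/negP => /asboolP[u Pu] /=.
rewrite mul0r !mulr1 subr0 mulr1 => u0.
by case/negP: Pu; rewrite u0 in_setE; case: (prime_is_ideal p).
Qed.

#[export] HB.instance Definition _ :=
  GRing.Zmodule_isComNzRing.Build type mulA mulC mul1 mulD one_neq0.

End Localization.

Module Exports. HB.reexport. End Exports.
End Localization.

Export Localization.Exports.

Notation localization := Localization.type.

HB.instance Definition _ (A : comNzRingType) := gen_eqMixin (prime_ideal A).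
HB.instance Definition _ (A : comNzRingType) := gen_choiceMixin (prime_ideal A).

Section IntegralMonomial.
Variables (A : comNzRingType) (I : set A).
Variables (B : comNzRingType) (f : {rmorphism B -> {poly A}}).
Hypothesis f_rees : forall b j, ideal_exp I j (f b)`_j.
Hypothesis f_surj : forall p : {poly A}, (forall j, ideal_exp I j p`_j) -> exists b, f b = p.

(* A homogeneous element x t^j is integral over the Rees ring iff x is integral
   over the ideal I^j. *)
Lemma integral_monomial j x :
  integral_closure (ideal_exp I j) x <-> integralOver f (x *: 'X^j).
Proof.
split=> [[m [a [m_gt0 Ia e]]]|[q q_mon /rootP qx0]].
  have /choice[c cE] (i : nat) :
      exists b, (i < m)%N -> f b = a (m - i)%N *: 'X^((m - i) * j).
    have [ltim|] := ltnP i m; last by exists 0.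
    suff [b fb] : exists b, f b = a (m - i)%N *: 'X^((m - i) * j) by exists b.
    apply: f_surj => k; rewrite coefZ coefXn.
    case: eqP => [->|_]; last by rewrite mulr0; case: (exp_ideal I k).
    by rewrite mulr1 -ideal_expM; apply: Ia; rewrite subn_gt0 ltim leq_subr.
  exists ('X^m + \poly_(i < m) c i).
    by rewrite monicE lead_coefDl ?lead_coefXn // size_polyXn ltnS size_poly.
  apply/rootP; rewrite rmorphD /= map_polyXn hornerD hornerXn.
  rewrite (@horner_coef_wide _ m); last first.
    exact: leq_trans (size_poly _ _) (size_poly _ _).
  rewrite (eq_bigr (fun i : 'I_m => (a (m - i)%N * x ^+ i) *: 'X^(m * j))); last first.
    move=> i _; rewrite coef_map coef_poly ltn_ord /= cE //.
    rewrite exprZn -scalerAl -scalerAr scalerA -exprM -exprD.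
    by rewrite [(j * i)%N]mulnC -mulnDl subnK // ltnW.
  rewrite exprZn -exprM [(j * m)%N]mulnC -scaler_suml -scalerDl.
  rewrite (reindex_inj rev_ord_inj) /= big_add1 big_mkord in e *.
  rewrite (eq_bigr (fun i : 'I_m => a i.+1 * x ^+ (m - i.+1))) ?e ?scale0r //.
  by move=> i _; rewrite subKn.
pose m := (size q).-1.
have qE : size q = m.+1 by rewrite /m prednK // size_poly_gt0 monic_neq0.
have qm : q`_m = 1 by apply/eqP; rewrite -monicE.
have m_gt0 : (0 < m)%N.
  rewrite lt0n; apply/eqP => m0; move: qx0; rewrite m0 in qE qm.
  have -> : q = 1 by rewrite (size1_polyC (eq_leq qE)) qm.
  by rewrite rmorph1 hornerC => /eqP; rewrite oner_eq0.
exists m, (fun i => (f q`_(m - i))`_(i * j)); split=> // [i _|].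
  by rewrite ideal_expM; apply: f_rees.
move/(congr1 (fun p : {poly A} => p`_(m * j))): qx0.
rewrite coef0 (horner_coef_wide _ (size_poly _ _)) qE coef_sum big_ord_recr /=.
rewrite coef_poly ltnSn qm rmorph1 mul1r exprZn coefZ -exprM mulnC coefXn eqxx mulr1.
rewrite addrC => e; rewrite -[RHS]e; congr (_ + _).
rewrite big_add1 big_mkord (reindex_inj rev_ord_inj); apply: eq_bigr => i _ /=.
rewrite subnSK // (subKn (ltnW (ltn_ord i))) exprZn -exprM -scalerAr coefZ.
rewrite coefMXn coef_poly ltnS (ltnW (ltn_ord i)) mulrC.
by rewrite ltnNge leq_mul2l (ltnW (ltn_ord i)) orbT -mulnBr mulnC.
Qed.

End IntegralMonomial.

(* R[It] and its integral closure, as subrings of R[t]: the elements are the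
   polynomials a_0 + a_1 t + ... with a_j in I^j, respectively in the integral
   closure of I^j. *)
Section Rees.
Variables (A : comNzRingType) (I : set A).

Definition rees_pred : pred {poly A} :=
  fun p => `[< forall j, ideal_exp I j p`_j >].

Lemma rees_subring_closed : subring_closed rees_pred.
Proof.
split=> [|p q /asboolP Ip /asboolP Iq|p q /asboolP Ip /asboolP Iq]; apply/asboolP => j.
- by rewrite coef1; case: j => //= j; case: (exp_ideal I j.+1).
- by rewrite coefB; apply: idealB (exp_ideal _ _) _ _.
- rewrite coefM; apply: ideal_sum (exp_ideal _ _) _ => i _.
  by rewrite -[X in ideal_exp I X](subnKC (leq_ord i)); apply: ideal_exp_mulr.
Qed.

HB.instance Definition _ :=
  GRing.isSubringClosed.Build {poly A} rees_pred rees_subring_closed.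

Record rees := Rees { rees_val : {poly A}; _ : rees_val \in rees_pred }.
HB.instance Definition _ := [isSub for rees_val].
HB.instance Definition _ := [Choice of rees by <:].
HB.instance Definition _ := [SubChoice_isSubComNzRing of rees by <:].

Definition rees_closure_pred : pred {poly A} :=
  fun p => `[< forall j, integral_closure (ideal_exp I j) p`_j >].

Lemma reesP (x : rees) j : ideal_exp I j (val x)`_j.
Proof. by case: x => p /= /asboolP. Qed.

Lemma rees_surj (p : {poly A}) : (forall j, ideal_exp I j p`_j) -> exists x : rees, val x = p.
Proof. by move/asboolP => Ip; exists (Rees Ip). Qed.

Lemma rees_closure_subring_closed : subring_closed rees_closure_pred.
Proof.
pose f : {rmorphism rees -> {poly A}} := val.
have intP (p : {poly A}) :
    reflect (forall j, integralOver f (p`_j *: 'X^j)) (rees_closure_pred p).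
  by apply: (iffP (asboolP _)) => Ip j; apply/(integral_monomial reesP rees_surj).
split=> [|p q /intP Ip /intP Iq|p q /intP Ip /intP Iq]; apply/intP => j.
- rewrite coef1; case: j => [|j] /=; first by rewrite scale1r; apply: (integral1 f).
  by rewrite scale0r; apply: (integral0 f).
- by rewrite coefB scalerBl; apply: (@integral_sub _ _ f).
- rewrite coefM scaler_suml; apply: (big_ind (integralOver f)) => [||i _].
  + exact: (integral0 f).
  + exact: (@integral_add _ _ f).
  rewrite -[j in 'X^j](subnKC (leq_ord i)) exprD.
  by rewrite -scalerA (scalerAr q`_ _) scalerAl; apply: (@integral_mul _ _ f).
Qed.

HB.instance Definition _ :=
  GRing.isSubringClosed.Build {poly A} rees_closure_pred rees_closure_subring_closed.

Record rees_closure :=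
  ReesClosure { rees_closure_val : {poly A}; _ : rees_closure_val \in rees_closure_pred }.
HB.instance Definition _ := [isSub for rees_closure_val].
HB.instance Definition _ := [Choice of rees_closure by <:].
HB.instance Definition _ := [SubChoice_isSubComNzRing of rees_closure by <:].

(* The ideal generated by I in the integral closure of R[It]. *)
Definition extended_ideal : set rees_closure :=
  ideal_span [set p | exists2 f, I f & val p = f%:P].

End Rees.
Arguments extended_ideal {A} I.

Section AssociatedGraded.
Variables (A : comNzRingType) (I : idealr A).
Local Notation Iset := [set` I].

Lemma idealr_is_ideal : is_ideal Iset.
Proof.
split=> [|x y Ix Iy|a x Ix] /=; first exact: idealr0.
  exact: rpredD.
exact: idealMr.
Qed.

Lemma ideal_exp1 : ideal_exp Iset 1 = Iset.
Proof.
by rewrite ideal_expS [ideal_exp _ _]/= ideal_mulC ideal_mul1 //; apply: idealr_is_ideal.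
Qed.

Definition gr_ideal : pred (rees Iset) :=
  fun p => `[< forall j, ideal_exp Iset j.+1 (val p)`_j >].

Lemma gr_idealr_closed : idealr_closed gr_ideal.
Proof.
split=> [||p x y /asboolP Jx /asboolP Jy].
- by apply/asboolP => j; rewrite coef0; case: (exp_ideal Iset j.+1).
- apply/negP => /asboolP /(_ 0%N); rewrite ideal_exp1 coef1 /=.
  by rewrite idealr1.
apply/asboolP => j; rewrite rmorphD rmorphM coefD coefM.
case: (exp_ideal Iset j.+1) => _ JD _; apply: JD => //.
apply: ideal_sum (exp_ideal _ _) _ => i _.
rewrite -[X in ideal_exp _ X.+1](subnKC (leq_ord i)) -addnS.
by apply: ideal_exp_mulr => //; apply: reesP.
Qed.

HB.instance Definition _ := isIdealr.Build (rees Iset) gr_ideal gr_idealr_closed.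

(* gr_I(A), the direct sum of the I^j / I^(j+1): families of classes are
   represented by polynomials with j-th coefficient in I^j, modulo those with
   j-th coefficient in I^(j+1), and multiplied as polynomials. *)
Definition gr : Type := {ideal_quot (gr_ideal : idealr (rees Iset))}.
HB.instance Definition _ := GRing.ComNzRing.on gr.

(* Behrend's formula when A / I is zero-dimensional: every contraction of P to
   A / I has dimension 0 and local Euler obstruction 1. *)
Definition behrend_nu (R : realType) : \bar R :=
  \esum_(P in [set P : prime_ideal gr | minimal_prime_over [set 0] P])
     ring_length (localization P) R.

End AssociatedGraded.

Section Valuations.
Variables (K : fieldType).
Implicit Types (v : K -> \bar int).

Definition normalized_valuation v : Prop :=
  [/\ forall x, v x = +oo%E <-> x = 0,
      forall x, v x <> -oo%E,
      forall x y, v (x * y) = (v x + v y)%E,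
      forall x y, (Order.min (v x) (v y) <= v (x + y)%R)%E
    & exists x, v x = 1%E].

Definition valuation_ring v : set K := [set x | (0 <= v x)%E].

(* The minimum of v on X, which exists when X contains a nonzero element and v
   is nonnegative on X. *)
Definition valuation_min v (X : set K) : \bar int :=
  xget +oo%E [set m | (exists2 x, X x & v x = m) /\ forall x, X x -> (m <= v x)%E].

End Valuations.

Section ReesValuations.
Variables (D : idomainType) (I : set D).
Local Notation K := {fraction {poly D}}.

(* The localization at Q, as a subring of Frac(D[t]); the latter is the field of
   fractions of the integral closure of D[It] as soon as I is nonzero. *)
Definition rees_closure_at (Q : prime_ideal (rees_closure I)) : set K :=
  [set z | exists x s : rees_closure I,
     ~ prime_set Q s /\ z = tofrac (val x) / tofrac (val s)].

Definition rees_valuation (v : K -> \bar int) : Prop :=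
  normalized_valuation v /\
  exists Q : prime_ideal (rees_closure I),
    minimal_prime_over (extended_ideal I) Q /\ valuation_ring v = rees_closure_at Q.

Definition valuation_of_ideal (v : K -> \bar int) : \bar int :=
  valuation_min v [set tofrac f%:P | f in I].

End ReesValuations.

Definition origin_ideal (n : nat) (k : comNzRingType) : set (mpoly n k) :=
  ideal_span (range (fun i : 'I_n => mpolyX k (mnm1 i))).
Arguments origin_ideal n k : clear implicits.

(* Main.v *)
Require Import Defs.
From HB Require Import structures.
From mathcomp Require Import all_boot all_order all_algebra.
From mathcomp Require Import all_classical reals ereal esum.
From mathcomp Require Import complex ring zify.
From mathcomp Require Import -(notations) mpoly.

Set Implicit Arguments.
Unset Strict Implicit.
Unset Printing Implicit Defensive.

Import Order.TTheory GRing.Theory Num.Theory.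
Local Open Scope classical_set_scope.
Local Open Scope ring_scope.

(** Write D for the polynomial ring, S for the integral closure of the Rees ring
    D[It], and K for the fraction field of D[t]. Normality of I says that
    S = D[It], so that gr_I(D) is the quotient of S by the ideal IS, and the
    minimal primes P of gr_I(D) are the images of the minimal primes Q of IS
    ([gr_presentation], [minimal_prime_preimage]). It remains to see, for each
    such Q, that S_Q is a discrete valuation ring of K, the valuation ring of a
    Rees valuation v, and that the length of gr_I(D)_P = S_Q / I S_Q is v(I).

    Three properties of S make S_Q a discrete valuation ring.
    - S is Noetherian, as a quotient of a polynomial ring over D
      ([noetherian_rees_closure], from Hilbert's basis theorem).
    - S is integrally closed in K ([rees_closure_normal]). Indeed D[t] is normal,
      and an element of D[t] that is integral over S has all its homogeneous
      parts integral over S, which places its coefficients in the integral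
      closures of the powers I^j. Both steps, as well as the passage from A to
      A[t] in the proof that D is normal, rest on [integral_coefX].
    - I S_Q is principal. Some g in I has gt outside Q, and then every a in I is
      (at / gt) g. If It were contained in Q, then Q would contain m S + It S with
      m the maximal ideal at the origin; but this ideal strictly contains the
      prime of those p_0 + p_1 t + ... in S such that p_j has no term of degree
      jd, where d is the least order at the origin of an element of I; and that
      prime contains IS ([minimal_prime_not_irrelevant]).

    The prime Q, minimal over an ideal that is locally generated by g, is then
    the set of x such that xb lies in g S_Q, for some b outside g S_Q. As b/g is
    not in S_Q, it is not integral over it, so it does not map Q S_Q into
    itself; as it maps Q into S_Q, it takes some element q of Q to a unit, and
    this q generates Q S_Q ([local_uniformizer]). Since S is
    Noetherian, every nonzero element of K is a unit of S_Q times a power of q,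
    and the exponent is a normalized valuation ([uniformizer_val_normalized],
    [uniformizer_val_ring]).

    A normalized valuation is determined by its valuation ring
    ([normalized_valuation_inj]), and Q can be recovered from S_Q, so Q |-> v is
    a bijection onto the Rees valuations. Finally v(I) = v(g), and
    the ideals of S_Q / g S_Q form a chain indexed by the possible values
    0, ..., v(g), which gives the length ([localization_length]). *)

(** * Noetherian rings *)

Section Noetherian.
Variable A : comNzRingType.
Implicit Types (J : set A) (X Y : set A).

Definition noetherian : Prop :=
  forall J, is_ideal J -> exists s : seq A, J = ideal_span [set` s].

Lemma subset_ideal_span X : X `<=` ideal_span X.
Proof. by move=> x Xx J _; apply. Qed.

Lemma ideal_span_sub X J : is_ideal J -> X `<=` J -> ideal_span X `<=` J.
Proof. by move=> iJ XJ x; apply. Qed.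

Lemma ideal_spanS X Y : X `<=` Y -> ideal_span X `<=` ideal_span Y.
Proof.
by move=> XY; apply: ideal_span_sub (span_ideal _) _ => x /XY; apply: subset_ideal_span.
Qed.

Lemma noetherian_chain (J : nat -> set A) : noetherian ->
  (forall k, is_ideal (J k)) -> (forall k, J k `<=` J k.+1) ->
  exists N, forall k, J k `<=` J N.
Proof.
move=> noethA iJ Jsub.
have Jle i j : (i <= j)%N -> J i `<=` J j.
  by move/subnK <-; elim: (j - i)%N => // k IHk x /IHk /Jsub.
have [|s sE] := noethA (\bigcup_k J k).
  split=> [|x y [i _ Jx] [j _ Jy]|a x [i _ Jx]].
  - by exists 0%N => //; case: (iJ 0%N).
  - exists (maxn i j) => //; case: (iJ (maxn i j)) => _ JD _.
    by apply: JD; [apply: Jle (leq_maxl _ _) _ Jx|apply: Jle (leq_maxr _ _) _ Jy].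
  - by exists i => //; case: (iJ i) => _ _; apply.
suff [N sN] : exists N, forall x, x \in s -> J N x.
  exists N => k x Jx; have : (\bigcup_k J k) x by exists k.
  by rewrite sE; apply.
have : forall x, x \in s -> (\bigcup_k J k) x.
  by move=> x xs; rewrite sE; apply: subset_ideal_span.
elim: s {sE} => [|y s IHs] ys; first by exists 0%N.
have [x xs|N sN] := IHs; first by apply: ys; rewrite inE xs orbT.
have [M _ yM] := ys y (mem_head _ _); exists (maxn N M) => x.
rewrite inE => /predU1P[->|/sN]; first exact: Jle (leq_maxr _ _) _ yM.
exact: Jle (leq_maxl _ _) _.
Qed.

Lemma noetherian_seq (a : nat -> A) : noetherian ->
  exists N, ideal_span [set a k | k in [set k | (k < N)%N]] (a N).
Proof.
move=> noethA.
have [k||N sN] := @noetherian_chain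
  (fun N => ideal_span [set a k | k in [set k | (k < N)%N]]) noethA.
- exact: span_ideal.
- by move=> k; apply: ideal_spanS => _ [i /= ik <-]; exists i => //=; apply: leqW.
by exists N; apply: (sN N.+1); apply: subset_ideal_span; exists N => /=.
Qed.

(** If no member of F were maximal, iterating a choice of a strictly larger
    member would give a strictly increasing chain. *)
Lemma noetherian_max (F : set (set A)) J0 : noetherian ->
  (forall J, F J -> is_ideal J) -> F J0 ->
  exists2 J, F J & forall J', F J' -> J `<=` J' -> J' `<=` J.
Proof.
move=> noethA Fi FJ0; apply: contrapT => noMax.
have /choice[g gP] (J : set A) :
    exists J', F J -> [/\ F J', J `<=` J' & ~ J' `<=` J].
  have [FJ|] := pselect (F J); last by exists J.
  apply: contrapT => noJ'; apply: noMax; exists J => // J' FJ' JJ'.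
  by apply: contrapT => nJ; apply: noJ'; exists J'.
have FJ k : F (iter k g J0) by elim: k => //= k /gP[].
have [k|k|N sN] := @noetherian_chain (fun k => iter k g J0) noethA.
- exact: Fi.
- by case: (gP _ (FJ k)).
by case: (gP _ (FJ N)) => _ _; apply; apply: (sN N.+1).
Qed.

End Noetherian.

Lemma noetherian_field (F : fieldType) : noetherian F.
Proof.
move=> J iJ; have [J0 JD JM] := iJ; have [[x Jx x0]|noJ] := pselect (exists2 x, J x & x != 0).
  exists [:: 1]; apply/seteqP; split=> [y _ K [_ _ KM] K1|y _].
    by rewrite -[y]mulr1; apply: KM; apply: K1; rewrite /= inE.
  by rewrite -[y](mulfVK x0); apply: JM.
exists [::]; apply/seteqP; split=> [y Jy|]; last exact: ideal_span_sub.
have [->|y0] := eqVneq y 0; first by case: (span_ideal [set` [::] : seq F]).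
by case: noJ; exists y.
Qed.

(** Noetherianity passes to quotients: B is isomorphic to the image of g. The map
    i embeds B in an ambient ring, which makes it possible to present a subring
    of C by a morphism with values in C itself. *)
Lemma noetherian_image (A B C : comNzRingType) (g : {rmorphism A -> C})
    (i : {rmorphism B -> C}) :
  injective i -> (forall a, exists b, i b = g a) -> (forall b, exists a, g a = i b) ->
  noetherian A -> noetherian B.
Proof.
move=> i_inj gi ig noethA J iJ.
have [J0 JD JM] := iJ.
have [|s sE] := noethA [set a | exists2 b, J b & i b = g a].
  split=> [|x y [b Jb xE] [c Jc yE]|a x [b Jb xE]] /=.
  - by exists 0; rewrite ?rmorph0.
  - by exists (b + c); rewrite ?rmorphD ?xE ?yE //; apply: JD.
  - by have [d dE] := gi a; exists (d * b); rewrite ?rmorphM ?dE ?xE //; apply: JM.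
have /choice[h hP] := gi.
exists (map h s); apply/seteqP; split=> [b Jb|]; last first.
  apply: ideal_span_sub => // _ /mapP[a sa ->].
  have [b Jb] : [set a | exists2 b, J b & i b = g a] a by rewrite sE; apply: subset_ideal_span.
  by rewrite -hP => /i_inj <-.
have [a aE] := ig b.
have : [set a | exists2 b, J b & i b = g a] a by exists b.
rewrite sE => {}Ja.
suff [b' sb' /esym] : [set a | exists2 b, ideal_span [set` map h s] b & i b = g a] a.
  by rewrite aE => /i_inj ->.
apply: Ja => [|c sc]; last first.
  by exists (h c) => //; apply: subset_ideal_span; apply: map_f.
have [S0 SD SM] := span_ideal [set` map h s].
split=> [|x y [d Sd xE] [c Sc yE]|e x [d Sd xE]] /=.
- by exists 0; rewrite ?rmorph0.
- by exists (d + c); rewrite ?rmorphD ?xE ?yE //; apply: SD.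
- by have [d' dE] := gi e; exists (d' * d); rewrite ?rmorphM ?dE ?xE //; apply: SM.
Qed.

(** Were J not finitely generated, one could choose g_0, g_1, ... in J, each of
    least degree outside the ideal generated by the previous ones. The leading
    coefficient of some g_N is then a combination of the previous ones; since the
    degrees increase, a combination of g_0, ..., g_(N-1) has the same degree and
    leading coefficient as g_N, and subtracting it contradicts the choice of
    g_N. *)
Lemma hilbert_basis (A : comNzRingType) : noetherian A -> noetherian {poly A}.
Proof.
move=> noethA J iJ; apply: contrapT => nfg; have [J0 JD JM] := iJ.
pose sp (s : seq {poly A}) := ideal_span [set` s].
pose good s p := [/\ J p, ~ sp s p &
  forall q, J q -> ~ sp s q -> (size p <= size q)%N].
have /choice[g gP] (s : seq {poly A}) :
    exists p, (forall q, q \in s -> J q) -> good s p.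
  have [sJ|] := pselect (forall q, q \in s -> J q); last by exists 0.
  have [p0 [Jp0 sp0]] : exists p, J p /\ ~ sp s p.
    apply: contrapT => nop; apply: nfg; exists s; apply/seteqP; split=> [p Jp|].
      by apply: contrapT => sp'; apply: nop; exists p.
    exact: ideal_span_sub.
  have exn : exists n, `[< exists p, [/\ J p, ~ sp s p & size p = n] >].
    by exists (size p0); apply/asboolP; exists p0.
  case: (ex_minnP exn) => m /asboolP[p [Jp nsp <-]] mmin.
  exists p => _; split=> // q Jq nsq.
  by apply: mmin; apply/asboolP; exists q.
(* l k is the list of the first k choices. *)
pose l k := iter k (fun s => rcons s (g s)) [::].
have lJ k q : q \in l k -> J q.
  elim: k q => // k IHk q; rewrite /= mem_rcons inE => /predU1P[->|/IHk //].
  by case: (gP (l k) IHk).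
have gk k : good (l k) (g (l k)) by apply: gP; apply: lJ.
have lS i j : (i < j)%N -> g (l i) \in l j.
  elim: j => // j IHj; rewrite ltnS leq_eqVlt => /predU1P[->|/IHj lt] /=;
  by rewrite mem_rcons inE ?eqxx ?lt ?orbT.
have sz i j : (i <= j)%N -> (size (g (l i)) <= size (g (l j)))%N.
  move=> leij; have [_ _] := gk i; apply; first by case: (gk j).
  case: (gk j) => _ + _; apply: contra_not; apply: ideal_spanS => x /= xi.
  move/subnK: leij <-; elim: (j - i)%N => //= k IHk.
  by rewrite mem_rcons inE IHk orbT.
have [N] := noetherian_seq (fun k => lead_coef (g (l k))) noethA.
have [Jg nsg gmin] := gk N; set p := g (l N) in Jg nsg gmin *; set d := (size p).-1.
have p0 : p != 0 by apply/eqP => p0; apply: nsg; rewrite p0; case: (span_ideal [set` l N]).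
have szp : size p = d.+1 by rewrite prednK // size_poly_gt0.
have [S0 SD SM] := span_ideal [set` l N].
(* The coefficients of degree d of the combinations of degree at most d form an
   ideal, so it suffices that it contains the earlier leading coefficients. *)
move=> /(_ [set c | exists2 q, sp (l N) q & (size q <= d.+1)%N /\ q`_d = c])[||q sq [szq qd]].
- split=> [|a b [q sq [szq qd]] [r sr [szr rd]]|a b [q sq [szq qd]]] /=.
  + by exists 0 => //; rewrite size_poly0 coef0.
  + exists (q + r); first exact: SD.
    by rewrite coefD qd rd (leq_trans (size_polyD _ _)) // geq_max szq.
  + exists (a%:P * q); first exact: SM.
    by rewrite mul_polyC coefZ qd (leq_trans (size_scale_leq _ _)).
- move=> _ [k /= kN <-]; set r := g (l k).
  have szr : (size r <= d.+1)%N by rewrite -szp; apply: sz; apply: ltnW.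
  exists ('X^(d.+1 - size r) * r).
    by apply: SM; apply: subset_ideal_span; apply: lS.
  have [r0|r0] := eqVneq r 0.
    by rewrite r0 mulr0 size_poly0 coef0 lead_coef0.
  rewrite mulrC size_mulXn // subnK // coefMXn.
  have -> : (d - (d.+1 - size r))%N = (size r).-1.
    by have : (0 < size r)%N; [rewrite size_poly_gt0|move: szr; lia].
  have -> : (d < d.+1 - size r)%N = false.
    by have : (0 < size r)%N; [rewrite size_poly_gt0|move: szr; lia].
  by rewrite lead_coefE.
have /gmin : J (p - q).
  apply: idealB => //; move: sq; apply: ideal_span_sub => // x; exact: lJ.
have nspq : ~ sp (l N) (p - q).
  by move=> spq; apply: nsg; rewrite -[p](subrK q); apply: SD.
move=> /(_ nspq); rewrite leqNgt; apply/negP; rewrite negbK szp ltnS.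
apply/leq_sizeP => j; rewrite leq_eqVlt => /predU1P[<-|ltdj].
  by rewrite coefB qd lead_coefE subrr.
by rewrite coefB !nth_default ?subrr // ?szp // (leq_trans szq).
Qed.

(** * Polynomial rings in several variables *)

Lemma mpoly_morph_eq n (k A : comNzRingType) (f g : {rmorphism mpoly n k -> A}) :
  (forall c, f (mpolyC n c) = g (mpolyC n c)) ->
  (forall i, f (mpolyX k (mnm1 i)) = g (mpolyX k (mnm1 i))) -> f =1 g.
Proof.
move=> fgC fgX p; elim/mpolyind: p => [|c m p _ _ IHp]; first by rewrite !rmorph0.
rewrite !rmorphD IHp -mul_mpolyC !rmorphM fgC; congr (_ * _ + _).
by rewrite mpolyXE_id !rmorph_prod; apply: eq_bigr => i _; rewrite !rmorphXn fgX.
Qed.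

Lemma mpoly0_const (k : nzRingType) (p : mpoly 0 k) : exists c, p = mpolyC 0 c.
Proof.
exists (mcoeff mnm0 p); apply/mpolyP => m.
have -> : m = mnm0 by apply/mnmP => -[].
by rewrite mcoeffC eqxx mulr1.
Qed.

Section MultivariateAsUnivariate.
Variables (n : nat) (k : comNzRingType).

Definition poly_to_mpoly : {poly mpoly n k} -> mpoly n.+1 k :=
  horner_eval (mpolyX k (mnm1 ord_max)) \o map_poly (@mwiden n k).
HB.instance Definition _ := GRing.RMorphism.on poly_to_mpoly.

Lemma poly_to_mpolyC p : poly_to_mpoly p%:P = mwiden p.
Proof. by rewrite /poly_to_mpoly /= map_polyC /horner_eval hornerC. Qed.

Lemma poly_to_mpolyXn i : poly_to_mpoly 'X^i = mpolyX k (mnm1 ord_max) ^+ i.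
Proof. by rewrite /poly_to_mpoly /= map_polyXn /horner_eval hornerXn. Qed.

Lemma muniK : cancel (@muni n k) poly_to_mpoly.
Proof.
elim/mpolyind => [|c m p _ _ IHp]; first by rewrite !rmorph0.
rewrite muniD; apply: etrans (rmorphD poly_to_mpoly _ _) _; congr (_ + _); last exact: IHp.
rewrite muniZ -mul_polyC -mul_mpolyC.
apply: etrans (rmorphM poly_to_mpoly _ _) _; congr (_ * _).
  by apply: etrans (poly_to_mpolyC _) _; rewrite mwidenC.
rewrite muniE msuppX big_seq1 mcoeffX eqxx scale1r -mul_polyC.
apply: etrans (rmorphM poly_to_mpoly _ _) _.
apply: etrans (congr2 *%R (poly_to_mpolyC _) (poly_to_mpolyXn _)) _.
rewrite mwidenX mpolyXn; apply: etrans (esym (mpolyXD _ _ _)) _; congr mpolyX; apply/mnmP => i.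
rewrite mnmDE mulmnE mnm1E.
have [[j ->]|->] : (exists j : 'I_n, i = widen_ord (leqnSn n) j) \/ i = ord_max.
- have [lti|lei] := ltnP i n; [left; exists (Ordinal lti)|right]; apply: val_inj => //=.
  by apply/eqP; rewrite eqn_leq lei -ltnS ltn_ord.
- apply: etrans (congr1 (addn^~ _) (mnmwiden_widen _ _)) _.
  rewrite mnmE -val_eqE /= eqn_leq [X in X && _]leqNgt ltn_ord.
  by rewrite addn0.
- by apply: etrans (congr1 (addn^~ _) (mnmwiden_ordmax _)) _; rewrite eqxx mul1n.
Qed.

End MultivariateAsUnivariate.

Lemma noetherian_mpoly n (A : comNzRingType) : noetherian A -> noetherian (mpoly n A).
Proof.
move=> noethA; elim: n => [|n IHn].
  apply: (@noetherian_image A _ _ (@mpolyC 0 A) idfun (fun x y => id)) => [a|b|//].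
  - by exists (mpolyC 0 a).
  - by have [c ->] := mpoly0_const b; exists c.
apply: (@noetherian_image _ _ _ (@poly_to_mpoly n A) idfun (fun x y => id)) => [a|b|].
- by exists (poly_to_mpoly a).
- by exists (muni b); apply: muniK.
- exact: hilbert_basis.
Qed.

(** * Normal domains *)

(** The equation is q(a / b) = 0 multiplied by the power of b that clears the
    denominators, which avoids a choice of fraction field. *)
Definition normal_domain (A : idomainType) : Prop :=
  forall (a b : A) (q : {poly A}), q \is monic -> b != 0 ->
    \sum_(i < size q) q`_i * a ^+ i * b ^+ ((size q).-1 - i) = 0 ->
    exists c, a = b * c.

Lemma homogenize_root (A : idomainType) (K : idomainType) (f : {rmorphism A -> K})
    (q : {poly A}) a b z : injective f -> q != 0 -> b != 0 -> f a = f b * z ->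
  \sum_(i < size q) q`_i * a ^+ i * b ^+ ((size q).-1 - i) = 0 <->
  root (map_poly f q) z.
Proof.
move=> f_inj q0 b0 az.
have fb0 : f b != 0 by rewrite -(rmorph0 f) (inj_eq f_inj).
have -> : root (map_poly f q) z =
    (f (\sum_(i < size q) q`_i * a ^+ i * b ^+ ((size q).-1 - i)) == 0).
  rewrite rmorph_sum (eq_bigr (fun i : 'I_(size q) =>
      f b ^+ (size q).-1 * ((map_poly f q)`_i * z ^+ i))).
    rewrite -mulr_sumr mulf_eq0 expf_eq0 (negPf fb0) andbF rootE.
    by rewrite (@horner_coef_wide _ (size q)) ?size_poly.
  move=> i _; rewrite !rmorphM !rmorphXn az coef_map exprMn.
  have {2}-> : (size q).-1 = (i + ((size q).-1 - i))%N.
    by rewrite subnKC // -ltnS prednK // size_poly_gt0.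
  by rewrite exprD; ring.
by split=> [->|]; [rewrite rmorph0|rewrite -(rmorph0 f) (inj_eq f_inj) => /eqP].
Qed.

Lemma normal_domain_integral (A : idomainType) (K : fieldType)
    (f : {rmorphism A -> K}) a b : injective f -> normal_domain A -> b != 0 ->
  integralOver f (f a / f b) -> exists c, f a / f b = f c.
Proof.
move=> f_inj normA b0 [q q_mon qz].
have fb0 : f b != 0 by rewrite -(rmorph0 f) (inj_eq f_inj).
have az : f a = f b * (f a / f b) by rewrite mulrCA divff ?mulr1.
have [c ->] := normA a b q q_mon b0 ((homogenize_root f_inj (monic_neq0 q_mon) b0 az).2 qz).
by exists c; rewrite rmorphM mulrAC divff ?mul1r.
Qed.

Lemma coef_scaleX (L : comNzRingType) (p : {poly L}) c j :
  (p \Po (c *: 'X))`_j = c ^+ j * p`_j.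
Proof.
rewrite comp_polyE coef_sum (eq_bigr (fun i : 'I_(size p) =>
  if i == j :> nat then c ^+ j * p`_j else 0)).
  have [ltj|lej] := ltnP j (size p).
    by rewrite (bigD1 (Ordinal ltj)) //= eqxx big1 ?addr0 // => i /negPf; rewrite -val_eqE /= => ->.
  rewrite nth_default // mulr0 big1 // => i _; by case: ifP.
move=> i _; rewrite exprZn coefZ coefZ coefXn eq_sym.
by case: eqP => [->|]; rewrite ?mulr1 ?mulr0 // mulrC.
Qed.

(** The homogeneous parts of an integral element are integral when the base
    ring is stable under t |-> 2t and contains the inverses of the positive
    integers. Let d be the degree of p: then p(2t) - 2^d p(t) is integral, has
    smaller degree, and its coefficients are those of p multiplied by the
    nonzero integers 2^j - 2^d, so that induction on the degree applies. *)
Lemma integral_coefX (B L : comNzRingType) (f : {rmorphism B -> {poly L}}) (p : {poly L}) j :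
  (forall m : nat, exists b, f b * m.+1%:R = 1) ->
  (forall b, exists b', f b' = f b \Po (2%:R *: 'X)) ->
  integralOver f p -> integralOver f (p`_j *: 'X^j).
Proof.
move=> f_nat f_scale; have [d] := ubnP (size p); elim: d p j => // d IHd p j.
rewrite ltnS => szp intp.
pose s : {rmorphism {poly L} -> {poly L}} := comp_poly (2%:R *: 'X).
have ints : integralOver f (s p).
  have [q q_mon qp] := intp.
  apply: (@integral_root_monic _ _ f (s p) (map_poly s (map_poly f q))).
  - by rewrite !monic_map.
  - by rewrite rmorph_root.
  apply/integral_poly => i; rewrite !coef_map /=.
  by have [b' <-] := f_scale q`_i; apply: integral_id.
case: d IHd szp => [_|d IHd szp].
  by rewrite leqn0 size_poly_eq0 => /eqP->; rewrite coef0 scale0r; apply: integral0.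
have intr : integralOver f (s p - 2%:R ^+ d * p).
  apply: integral_sub => //; apply: integral_mul => //.
  by rewrite -natrX; apply: integral_nat.
have coefr i : (s p - 2%:R ^+ d * p)`_i = (2%:R ^+ i - 2%:R ^+ d) * p`_i.
  have -> : 2%:R ^+ d = (2%:R ^+ d)%:P :> {poly L} by rewrite rmorphXn rmorph_nat.
  by rewrite coefB coef_scaleX coefCM mulrBl.
have low i : (i < d)%N -> integralOver f (p`_i *: 'X^i).
  move=> ltid; have := IHd _ i _ intr.
  have -> : (s p - 2%:R ^+ d * p)`_i = - ((2 ^ d - 2 ^ i)%N%:R * p`_i).
    by rewrite coefr natrB ?leq_exp2l ?(ltnW ltid) // !natrX -mulNr opprB.
  have : (0 < 2 ^ d - 2 ^ i)%N by rewrite subn_gt0 ltn_exp2l.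
  case: (2 ^ d - 2 ^ i)%N => // m _.
  have [b bE] := f_nat m.
  move=> int; have -> : p`_i *: 'X^i = f (- b) * (- (m.+1%:R * p`_i) *: 'X^i).
    rewrite rmorphN scaleNr mulrNN -scalerA scaler_nat -mulr_natl mulrA bE mul1r //.
  apply: integral_mul; first exact: integral_id.
  apply: int; rewrite ltnS; apply/leq_sizeP => k lek.
  rewrite coefr; have [->|nekd] := eqVneq k d; first by rewrite subrr mul0r.
  by rewrite nth_default ?mulr0 // (leq_trans szp) // ltn_neqAle eq_sym nekd.
have [ltjd|] := ltnP j d; first exact: low.
rewrite leq_eqVlt => /predU1P[<-|ltdj]; last first.
  by rewrite nth_default ?scale0r; [apply: integral0|apply: leq_trans szp _].
have -> : p`_d *: 'X^d = p - \sum_(i < d) p`_i *: 'X^i.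
  have {2}-> : p = \sum_(i < d.+1) p`_i *: 'X^i.
    rewrite -poly_def; apply/polyP => i; rewrite coef_poly ltnS; case: leqP => // ltdi.
    by rewrite nth_default // (leq_trans szp).
  by rewrite big_ord_recr /= [RHS]addrC addKr.
apply: (@integral_sub _ _ f) => //; apply: (big_ind (integralOver f)) => [||i _].
- exact: integral0.
- exact: (@integral_add _ _ f).
- exact: low.
Qed.

Lemma fractionP (A : idomainType) (x : {fraction A}) :
  exists a b, b != 0 /\ x = tofrac a / tofrac b.
Proof.
elim/quotW: x => r; exists r.1, r.2; split; first exact: denom_ratioP.
unlock tofrac; rewrite -[X in _ * X]FracField.pi_inv -[RHS]FracField.pi_mul.
apply: congr1; rewrite /FracField.mulf /FracField.invf.
by rewrite !numden_Ratio ?oner_neq0 ?denom_ratioP // mulr1 mul1r Ratio_numden.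
Qed.

Lemma tofrac_inj (A : idomainType) : injective (@tofrac A).
Proof. by move=> x y /eqP; rewrite tofrac_eq => /eqP. Qed.

(** The rational root theorem: when a and b are divided by their gcd, the
    denominator divides a power of the numerator, hence is a unit. *)
Lemma normal_domain_poly_field (k : fieldType) : normal_domain {poly k}.
Proof.
move=> a b q q_mon b0 e; set m := (size q).-1 in e.
have szq : size q = m.+1 by rewrite prednK // size_poly_gt0 monic_neq0.
pose g := gcdp a b; pose a1 := a %/ g; pose b1 := b %/ g.
have aE : a = a1 * g by rewrite divpK // dvdp_gcdl.
have bE : b = b1 * g by rewrite divpK // dvdp_gcdr.
have g0 : g != 0 by rewrite gcdp_eq0 (negPf b0) andbF.
have co : coprimep b1 a1 by rewrite coprimep_sym coprimep_div_gcd ?b0 ?orbT.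
have e1 : \sum_(i < m.+1) q`_i * a1 ^+ i * b1 ^+ (m - i) = 0.
  apply: (mulfI (expf_neq0 m g0)); rewrite mulr0 -[RHS]e szq mulr_sumr.
  apply: eq_bigr => i _; rewrite aE bE !exprMn.
  have {1}-> : m = (i + (m - i))%N by rewrite subnKC // -ltnS.
  by rewrite exprD; ring.
have b1a1 : b1 %| a1 ^+ m.
  move: e1; rewrite big_ord_recr /= subnn mulr1.
  have -> : q`_m = 1 by apply/eqP; rewrite -monicE.
  rewrite mul1r addrC => /eqP; rewrite addr_eq0 => /eqP ->.
  rewrite dvdpNr; apply: (big_ind (dvdp b1)) => [||i _]; [exact: dvdp0|exact: dvdp_add|].
  by rewrite dvdp_mull // -(subnSK (ltn_ord i)) exprS dvdp_mulr.
have : b1 %| 1.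
  by rewrite -(Gauss_dvdpr 1 (coprimep_expr m co)) mulr1.
rewrite dvdp1 => /size_poly1P[c c0 b1E].
exists (c^-1 *: a1); rewrite {1}aE bE b1E mul_polyC -scalerAl -scalerAr scalerA.
by rewrite divff // scale1r mulrC.
Qed.

(** Over the fraction field of A, the quotient z of a by b is a polynomial. It is
    integral over A[t], hence so are its homogeneous parts z_j t^j; evaluating
    at t = 1, the coefficients z_j are integral over A. *)
Lemma normal_domain_poly (A : idomainType) :
  (forall m : nat, m.+1%:R \is a @GRing.unit A) ->
  normal_domain A -> normal_domain {poly A}.
Proof.
move=> natA normA a b q q_mon b0 e.
pose F : {rmorphism {poly A} -> {poly {fraction A}}} := map_poly (@tofrac A).
have F_inj : injective F by apply: map_inj_poly; [apply: tofrac_inj|apply: rmorph0].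
have Fb0 : F b != 0 by rewrite -(rmorph0 F) (inj_eq F_inj).
have [z az] : exists z, F a = F b * z.
  apply: (normal_domain_poly_field (q := map_poly F q)) => //.
    by rewrite monic_map.
  transitivity (F (\sum_(i < size q) q`_i * a ^+ i * b ^+ ((size q).-1 - i))).
    rewrite rmorph_sum size_map_inj_poly ?rmorph0 //.
    by apply: eq_bigr => i _; rewrite !rmorphM !rmorphXn coef_map.
  by rewrite e rmorph0.
have intz : integralOver F z.
  by exists q => //; apply/(homogenize_root F_inj (monic_neq0 q_mon) b0 az).
have zA j : exists c, z`_j = tofrac c.
  have [n [d [d0 zj]]] := fractionP z`_j.
  rewrite zj; apply: normal_domain_integral d0 _ => //; first exact: tofrac_inj.
  rewrite -zj; have : integralOver F (z`_j *: 'X^j).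
    apply: integral_coefX intz => [m|p].
      exists (m.+1%:R^-1)%:P; rewrite -(rmorph_nat F m.+1) -rmorphM.
      by rewrite -(rmorph_nat (@polyC A) m.+1) -rmorphM mulVr ?rmorph1.
    exists (p \Po (2%:R *: 'X)).
    by rewrite /F /= map_comp_poly map_polyZ map_polyX rmorph_nat.
  case=> p p_mon rp; exists (map_poly (horner_eval 1) p); first by rewrite monic_map.
  pose ev : {rmorphism {poly {fraction A}} -> {fraction A}} := horner_eval 1.
  have evz : ev (z`_j *: 'X^j) = z`_j.
    by rewrite /ev /= /horner_eval hornerZ hornerXn expr1n mulr1.
  have := rmorph_root ev rp; rewrite evz -!map_poly_comp.
  congr (is_true (root _ _)); apply: eq_map_poly => r.
  by rewrite /= /horner_eval -horner_map rmorph1.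
have /choice[c cE] := zA.
exists (\poly_(i < size z) c i); apply: F_inj; rewrite az rmorphM; congr (_ * _).
apply/polyP => i; rewrite coef_map coef_poly /=; case: ltnP => lti; first by rewrite cE.
by rewrite nth_default // rmorph0.
Qed.

(** Quotients computed in A[t], for A the ring in one variable less, come back through
    the retraction [poly_to_mpoly] of the embedding [muni]. *)
Lemma normal_domain_mpoly n (F : numFieldType) : normal_domain (mpoly n F).
Proof.
elim: n => [|n IHn] a b q q_mon b0 e.
  have [c aE] := mpoly0_const a; have [d bE] := mpoly0_const b.
  exists (mpolyC 0 (c / d)); rewrite aE bE -rmorphM mulrCA divff ?mulr1 //.
  by apply: contraNneq b0 => d0; rewrite bE d0 rmorph0.
pose f : {rmorphism mpoly n.+1 F -> {poly mpoly n F}} := @muni n F.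
have f_inj : injective f := can_inj (@muniK n F).
have natA (m : nat) : m.+1%:R \is a @GRing.unit (mpoly n F).
  by rewrite -(rmorph_nat (@mpolyC n F)) rmorph_unit // unitfE pnatr_eq0.
have [|||c ac] := normal_domain_poly natA IHn (a := f a) (b := f b) (q := map_poly f q).
- by rewrite monic_map.
- by rewrite -(rmorph0 f) (inj_eq f_inj).
- transitivity (f (\sum_(i < size q) q`_i * a ^+ i * b ^+ ((size q).-1 - i))).
    rewrite rmorph_sum size_map_inj_poly ?rmorph0 //.
    by apply: eq_bigr => i _; rewrite !rmorphM !rmorphXn coef_map.
  by rewrite e rmorph0.
exists (poly_to_mpoly c); rewrite -[a in LHS](@muniK n F) -[b in RHS](@muniK n F).
by rewrite -(rmorphM (@poly_to_mpoly n F)); congr poly_to_mpoly.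
Qed.

(** * Normalized valuations *)

Section NormalizedValuation.
Variables (K : fieldType) (v : K -> \bar int).
Hypothesis v_norm : normalized_valuation v.

Lemma nval0 : v 0 = +oo%E. Proof. by case: v_norm => /(_ 0)[_ ->]. Qed.

Lemma nval_fin x : x != 0 -> v x = (fine (v x))%:E.
Proof.
case: v_norm => vy vNy _ _ _ x0; case vx: (v x) => [//||].
  by move/vy: vx => vx; rewrite vx eqxx in x0.
by case: (vNy x).
Qed.

Lemma nvalM x y : v (x * y) = (v x + v y)%E. Proof. by case: v_norm => _ _ ->. Qed.

Lemma nval1 : v 1 = 0%E.
Proof.
have := nvalM 1 1; rewrite mulr1 nval_fin ?oner_neq0 // -EFinD => -[e].
by have -> : fine (v 1) = 0 by lia.
Qed.

Lemma nvalV x : x != 0 -> v x^-1 = (- v x)%E.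
Proof.
move=> x0; have := nvalM x x^-1; rewrite divff // nval1.
rewrite [v x]nval_fin // [v x^-1]nval_fin ?invr_eq0 // -EFinD -EFinN => -[e].
by congr EFin; lia.
Qed.

Lemma nval_fineM x y : x != 0 -> y != 0 -> fine (v (x * y)) = fine (v x) + fine (v y).
Proof. by move=> x0 y0; rewrite nvalM fineD // nval_fin. Qed.

Lemma nval_fineX x (k : int) : x != 0 -> fine (v (x ^ k)) = fine (v x) * k.
Proof.
move=> x0; have nat (n : nat) : fine (v (x ^+ n)) = fine (v x) * n%:Z.
  elim: n => [|n IHn]; first by rewrite nval1 mulr0.
  by rewrite exprS nval_fineM ?expf_neq0 // IHn intS mulrDr mulr1.
case: k => n; first exact: nat.
by rewrite NegzE -exprnN nvalV ?expf_neq0 // fineN nat mulrN.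
Qed.

Lemma nval_ge0_div x y : x != 0 -> (0 <= v (y / x))%E = (v x <= v y)%E.
Proof.
move=> x0; have [->|y0] := eqVneq y 0; first by rewrite mul0r nval0 !leey.
rewrite nvalM nvalV // (nval_fin x0) (nval_fin y0) -EFinN -EFinD !lee_fin.
by rewrite subr_ge0.
Qed.

Lemma nvalD x y (m : \bar int) : (m <= v x)%E -> (m <= v y)%E -> (m <= v (x + y))%E.
Proof.
case: v_norm => _ _ _ vD _ mx my; apply: le_trans (vD x y).
by rewrite le_min mx.
Qed.

End NormalizedValuation.

(** Let v(x) = 1. A nonzero z is x^(v(z)) times a unit of the common valuation
    ring, so w(z) = v(z) w(x). As w takes the value 1 and w(x) >= 0, w(x) = 1. *)
Lemma normalized_valuation_inj (K : fieldType) (v w : K -> \bar int) :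
  normalized_valuation v -> normalized_valuation w ->
  valuation_ring v = valuation_ring w -> v = w.
Proof.
move=> nv nw vw; have vwE x : (0 <= v x)%E = (0 <= w x)%E.
  have : valuation_ring v x = valuation_ring w x by rewrite vw.
  by rewrite /valuation_ring /= => /propeqP/Bool.eq_iff_eq_true.
have [x vx] : exists x, v x = 1%E by case: nv.
have [y wy] : exists y, w y = 1%E by case: nw.
have x0 : x != 0 by apply/eqP => x0; move: vx; rewrite x0 nval0.
have y0 : y != 0 by apply/eqP => y0; move: wy; rewrite y0 nval0.
have wE z : z != 0 -> fine (w z) = fine (v z) * fine (w x).
  move=> z0; pose u := z / x ^ (fine (v z)).
  have xk0 : x ^ (fine (v z)) != 0 by rewrite expfz_neq0.
  have vu : v u = 0%E.
    rewrite /u nvalM // nvalV // (nval_fin nv z0) (nval_fin nv xk0) nval_fineX // vx.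
    by rewrite mul1r -EFinN -EFinD subrr.
  have u0 : u != 0 by rewrite mulf_neq0 ?invr_eq0.
  have wu : w u = 0%E.
    apply/eqP; rewrite eq_le -[(0 <= _)%E]vwE vu lexx andbT.
    have := vwE u^-1; rewrite !nvalV // vu oppe0 lexx => /esym.
    by rewrite (nval_fin nw u0) -EFinN !lee_fin oppr_ge0.
  have {1}-> : z = u * x ^ (fine (v z)) by rewrite mulfVK.
  by rewrite nval_fineM // wu nval_fineX // add0r mulrC.
have wx : fine (w x) = 1.
  have : (0 <= w x)%E by rewrite -vwE vx lee_fin.
  rewrite (nval_fin nw x0) lee_fin; have := wE y y0; rewrite wy /=.
  move: (fine (w x)) (fine (v y)) => [a|//] b /(congr1 absz).
  by rewrite abszM /= => /esym/eqP; rewrite muln_eq1 => /andP[_ /eqP ->].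
apply/funext => z; have [->|z0] := eqVneq z 0; first by rewrite !nval0.
by rewrite (nval_fin nv z0) (nval_fin nw z0) wE // wx mulr1.
Qed.

(** * The discrete valuation ring at a height one prime *)

(** The elements w^k x0 all lie in J, so some w^N x0 is a combination of the
    previous ones; dividing by x0 gives an equation of integral dependence. *)
Lemma integral_of_stable (S : comNzRingType) (K : fieldType)
    (f : {rmorphism S -> K}) (J : set S) x0 w :
  noetherian S -> J x0 -> f x0 != 0 ->
  (forall x, J x -> exists2 y, J y & f y = w * f x) -> integralOver f w.
Proof.
move=> noethS Jx0 fx0 Jw.
have /choice[h hP] (x : S) : exists y, J x -> J y /\ f y = w * f x.
  by have [/Jw[y Jy yE]|] := pselect (J x); [exists y|exists 0].
have hk k : J (iter k h x0) /\ f (iter k h x0) = w ^+ k * f x0.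
  elim: k => [|k [Jk kE]]; first by rewrite mul1r.
  by have [? ->] := hP _ Jk; rewrite kE exprS mulrA.
have [N] := noetherian_seq (fun k => iter k h x0) noethS.
move=> /(_ [set x | exists p : {poly S}, (size p <= N)%N /\
    f x = f x0 * (map_poly f p).[w]])[||p [szp]].
- split=> [|x y [p [szp xE]] [q [szq yE]]|a x [p [szp xE]]] /=.
  + by exists 0; rewrite size_poly0 !rmorph0 horner0 mulr0.
  + exists (p + q); rewrite (leq_trans (size_polyD _ _)) ?geq_max ?szp //.
    by rewrite !rmorphD hornerD xE yE mulrDr.
  + exists (a *: p); rewrite (leq_trans (size_scale_leq _ _)) //.
    by rewrite map_polyZ hornerZ rmorphM xE mulrCA.
- move=> _ [k /= kN <-]; exists 'X^k; rewrite size_polyXn; split=> //.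
  by rewrite map_polyXn hornerXn mulrC; case: (hk k).
rewrite (hk N).2 mulrC => /(mulfI fx0) wN.
exists ('X^N - p).
  by rewrite monicE lead_coefDl ?lead_coefXn // size_polyN size_polyXn ltnS.
by rewrite rootE rmorphB /= map_polyXn hornerD hornerN hornerXn wN subrr.
Qed.

Section LocalRing.
Variables (S : comNzRingType) (K : fieldType) (f : {rmorphism S -> K}).
Variable Q : prime_ideal S.
Hypothesis f_inj : injective f.

Definition local_ring : set K :=
  [set z | exists x s, ~ prime_set Q s /\ z = f x / f s].
Local Notation O := local_ring.

Lemma morph_neq0 x : x != 0 -> f x != 0.
Proof. by rewrite -(inj_eq f_inj) rmorph0. Qed.

Lemma notin_prime_neq0 s : ~ prime_set Q s -> f s != 0.
Proof.
move=> Qs; apply: morph_neq0; apply: contra_notN Qs => /eqP ->.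
by case: (prime_is_ideal Q).
Qed.

Lemma notin_primeM s t : ~ prime_set Q s -> ~ prime_set Q t -> ~ prime_set Q (s * t).
Proof. by move=> Qs Qt /prime_mulP[]. Qed.

Lemma local_ring_morph x : O (f x).
Proof. by exists x, 1; split; [apply: prime_proper|rewrite rmorph1 divr1]. Qed.

Lemma local_ringD x y : O x -> O y -> O (x + y).
Proof.
move=> [a [s [Qs ->]]] [b [t [Qt ->]]]; exists (a * t + b * s), (s * t).
split; first exact: notin_primeM.
by rewrite rmorphD !rmorphM -addf_div ?notin_prime_neq0.
Qed.

Lemma local_ringM x y : O x -> O y -> O (x * y).
Proof.
move=> [a [s [Qs ->]]] [b [t [Qt ->]]]; exists (a * b), (s * t).
by split; [apply: notin_primeM|rewrite !rmorphM mulf_div].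
Qed.

Lemma local_ringX x k : O x -> O (x ^+ k).
Proof.
move=> Ox; elim: k => [|k IHk]; first by rewrite expr0 -(rmorph1 f); apply: local_ring_morph.
by rewrite exprS; apply: local_ringM.
Qed.

Lemma local_ringV s : ~ prime_set Q s -> O (f s)^-1.
Proof. by exists 1, s; rewrite rmorph1 mul1r. Qed.

Lemma local_ring_inv_prime q : prime_set Q q -> f q != 0 -> ~ O (f q)^-1.
Proof.
move=> Qq q0 [x [s [Qs e]]]; have fs0 := notin_prime_neq0 Qs; apply: Qs.
suff -> : s = x * q by case: (prime_is_ideal Q) => _ _; apply.
by apply: f_inj; rewrite rmorphM -[f x](mulfVK fs0) -e mulrAC mulVf ?mul1r.
Qed.

Hypothesis noethS : noetherian S.

(** For b outside g S_Q, the colon ideal of b is the set of x such that xb lies in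
    g S_Q. A maximal one among these ideals is prime: if xy is in the colon
    ideal of b and x is not, then xb is outside g S_Q, and its colon ideal is
    no larger than that of b but contains y. It is contained in Q because the
    elements outside Q are units of S_Q. *)
Lemma colon_prime g : g != 0 -> prime_set Q g ->
  exists b, [/\ ~ O (f b / f g),
     is_ideal [set x | O (f x * (f b / f g))],
     forall x y, O (f (x * y) * (f b / f g)) ->
       O (f x * (f b / f g)) \/ O (f y * (f b / f g)) &
     forall x, O (f x * (f b / f g)) -> prime_set Q x].
Proof.
move=> g0 Qg; have fg0 := morph_neq0 g0.
pose C b := [set x | O (f x * (f b / f g))].
have iC b : is_ideal (C b).
  split=> [|x y Cx Cy|a x Cx]; rewrite /C /=.
  - by rewrite rmorph0 mul0r -(rmorph0 f); apply: local_ring_morph.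
  - by rewrite rmorphD mulrDl; apply: local_ringD.
  - by rewrite rmorphM -mulrA; apply: local_ringM => //; apply: local_ring_morph.
have [||J [b Ob <-] Jmax] := @noetherian_max S [set C b | b in [set b | ~ O (f b / f g)]]
    (C 1) noethS.
- by move=> _ [b _ <-].
- by exists 1 => //=; rewrite rmorph1 mul1r; apply: local_ring_inv_prime.
exists b; split; [by []|exact: (iC b)|move=> x y Oxy|move=> x Ox].
  have [|Ox] := pselect (O (f x * (f b / f g))); [by left|right].
  suff sub : C (x * b) `<=` C b.
    apply: (sub y); rewrite /C /=; move: Oxy; rewrite !rmorphM.
    by congr (O _); ring.
  apply: Jmax; first by exists (x * b) => //=; rewrite rmorphM -mulrA.
  move=> z Oz; rewrite /C /= rmorphM -[f x * f b / _]mulrA mulrCA.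
  by apply: local_ringM => //; apply: local_ring_morph.
apply: contrapT => Qx; apply: Ob.
rewrite -[_ / _](mulKf (notin_prime_neq0 Qx)); apply: local_ringM => //.
exact: local_ringV.
Qed.

(** The prime of [colon_prime] contains J, because J is contained in g S_Q; by
    minimality it is Q. With w = b / g, this means that w Q is contained in S_Q but w is not an
    element of S_Q. If w Q were contained in Q S_Q, a common denominator t
    outside Q for the images of finitely many generators would make t w stable
    on Q, hence integral over S, hence an element of S. So q w is a unit for some
    q in Q, and x / q = (x w) / (q w) is in S_Q for every x in Q. *)
Lemma local_uniformizer (J : set S) g :
  (forall a b, b != 0 -> integralOver f (f a / f b) -> exists c, f a / f b = f c) ->
  minimal_prime_over J Q -> J g -> g != 0 -> (forall x, J x -> O (f x / f g)) ->
  exists q, [/\ prime_set Q q, q != 0 & forall x, prime_set Q x -> O (f x / f q)].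
Proof.
move=> normS [JQ Qmin] Jg g0 Jgen; have Qg := JQ _ Jg.
have fg0 := morph_neq0 g0.
have [b [Ob iC primeC CQ]] := colon_prime g0 Qg; set w := f b / f g in Ob iC primeC CQ.
have C1 : ~ [set x | O (f x * w)] 1 by rewrite /= rmorph1 mul1r.
have QE : [set x | O (f x * w)] = prime_set Q.
  apply: (Qmin (PrimeIdeal iC C1 primeC)) => //= x Jx.
  rewrite /=; have -> : f x * w = f x / f g * f b by rewrite /w; ring.
  by apply: local_ringM; [apply: Jgen|apply: local_ring_morph].
have Qw x : prime_set Q x -> O (f x * w) by rewrite -QE.
have [[q [Qq [u [s [Qu [Qs e]]]]]]|noq] := pselect (exists q, prime_set Q q /\
    exists u s, ~ prime_set Q u /\ ~ prime_set Q s /\ f q * w = f u / f s).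
  have [fu0 fs0] := (notin_prime_neq0 Qu, notin_prime_neq0 Qs).
  have fq0 : f q != 0.
    apply/eqP => q0; move/eqP: e; rewrite q0 mul0r eq_sym mulf_eq0 invr_eq0.
    by rewrite (negPf fu0) (negPf fs0).
  exists q; split=> //; first by apply: contraNneq fq0 => ->; rewrite rmorph0.
  move=> x /Qw Ox; have -> : f x / f q = (f x * w) * f s * (f u)^-1.
    have -> : (f q)^-1 = w * f s / f u; last by rewrite !mulrA.
    rewrite -[w](mulKf fq0) e.
    by field; rewrite fq0 fu0 fs0.
  by apply: local_ringM (local_ringV Qu); apply: local_ringM => //; apply: local_ring_morph.
exfalso; have {noq}Qw' x : prime_set Q x ->
    exists s y, [/\ ~ prime_set Q s, prime_set Q y & f (s * x) * w = f y].
  move=> Qx; have [y [s [Qs e]]] := Qw _ Qx.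
  exists s, y; split=> //; last first.
    by rewrite rmorphM -mulrA e mulrC mulfVK // notin_prime_neq0.
  by apply: contrapT => Qy; apply: noq; exists x; split=> //; exists y, s.
have [gen genE] := noethS (prime_is_ideal Q).
have [t Qt tw] : exists2 t, ~ prime_set Q t &
    forall x, x \in gen -> exists2 y, prime_set Q y & f (t * x) * w = f y.
  have : forall x, x \in gen -> prime_set Q x.
    by move=> x xg; rewrite genE; apply: subset_ideal_span.
  elim: gen {genE} => [_|x gen IHg Qgen]; first by exists 1 => //; apply: prime_proper.
  have [y ygen|t Qt tgen] := IHg; first by apply: Qgen; rewrite inE ygen orbT.
  have [s [y [Qs Qy sx]]] := Qw' x (Qgen x (mem_head _ _)).
  have [_ _ QM] := prime_is_ideal Q.
  exists (t * s); first exact: notin_primeM.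
  move=> z; rewrite inE => /predU1P[->|/tgen[z' Qz' tz]].
    by exists (t * y); [exact: QM|rewrite -mulrA rmorphM -mulrA sx rmorphM].
  exists (s * z'); first exact: QM.
  by rewrite [t * s]mulrC -mulrA rmorphM -mulrA tz rmorphM.
have [Q0 QD QM] := prime_is_ideal Q.
have twQ x : prime_set Q x -> exists2 y, prime_set Q y & f y = f t * w * f x.
  rewrite {1}genE => /(_ [set x | exists2 y, prime_set Q y & f y = f t * w * f x])[||y Qy yE].
  - split=> [|y z [y' Qy' yE] [z' Qz' zE]|a y [y' Qy' yE]] /=.
    + by exists 0; rewrite // rmorph0 mulr0.
    + by exists (y' + z'); [apply: QD|rewrite !rmorphD yE zE mulrDr].
    + by exists (a * y'); [apply: QM|rewrite !rmorphM yE mulrCA].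
  - by move=> y /tw[z Qz zE]; exists z; rewrite // -zE rmorphM mulrAC.
  by exists y.
have := integral_of_stable noethS Qg fg0 twQ; rewrite /w mulrA -rmorphM.
move=> /(normS _ _ g0)[c cE]; apply: Ob.
exists c, t; split=> //; rewrite -cE rmorphM -[f t * f b / f g]mulrA [RHS]mulrC mulKf //.
exact: notin_prime_neq0.
Qed.

End LocalRing.

(** ** The valuation defined by a uniformizer *)

Section ValuationOfUniformizer.
Variables (S : comNzRingType) (K : fieldType) (f : {rmorphism S -> K}).
Variables (Q : prime_ideal S) (q : S).
Hypothesis f_inj : injective f.
Hypothesis noethS : noetherian S.
Hypothesis f_frac : forall z, exists a b, b != 0 /\ z = f a / f b.
Hypothesis Qq : prime_set Q q.
Hypothesis q0 : q != 0.
Hypothesis q_gen : forall x, prime_set Q x -> local_ring f Q (f x / f q).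
Local Notation O := (local_ring f Q).
Local Notation pi := (f q).

Let unit z := exists a s, [/\ ~ prime_set Q a, ~ prime_set Q s & z = f a / f s].

Let pi0 : pi != 0. Proof. exact: morph_neq0. Qed.
Let Opi : O pi. Proof. exact: local_ring_morph. Qed.
Let OpiV : ~ O pi^-1. Proof. exact: local_ring_inv_prime. Qed.

Let unit_O z : unit z -> O z.
Proof. by move=> [a [s [Qa Qs ->]]]; exists a, s. Qed.

Let unitM y z : unit y -> unit z -> unit (y * z).
Proof.
move=> [a [s [Qa Qs ->]]] [b [t [Qb Qt ->]]]; exists (a * b), (s * t).
by split; [apply: notin_primeM|apply: notin_primeM|rewrite !rmorphM mulf_div].
Qed.

Let unitV z : unit z -> unit z^-1.
Proof. by move=> [a [s [Qa Qs ->]]]; exists s, a; rewrite invf_div. Qed.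

Let unit_neq0 z : unit z -> z != 0.
Proof.
move=> [a [s [Qa Qs ->]]].
by rewrite mulf_neq0 ?invr_eq0 ?(notin_prime_neq0 f_inj Qa) ?(notin_prime_neq0 f_inj Qs).
Qed.

Let unit_or_div z : O z -> unit z \/ O (z / pi).
Proof.
move=> [a [s [Qs ->]]]; have [Qa|Qa] := pselect (prime_set Q a); last first.
  by left; exists a, s.
by right; rewrite mulrAC; apply: local_ringM (q_gen Qa) (local_ringV _ Qs).
Qed.

Let unit_pi_ge0 u (k : int) : unit u -> O (u * pi ^ k) <-> 0 <= k.
Proof.
move=> unitu; have u0 := unit_neq0 unitu; split; last first.
  by case: k => // k _; apply: local_ringM; [apply: unit_O|apply: local_ringX].
case: k => // k Ok; exfalso; apply: OpiV.
have -> : pi^-1 = (u * pi ^ Negz k) * u^-1 * pi ^+ k.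
  by rewrite NegzE -exprnN exprS; field; rewrite u0 pi0 expf_neq0.
apply: local_ringM => //; last exact: local_ringX.
by apply: local_ringM => //; apply: unit_O; apply: unitV.
Qed.

(** If x were divisible by all powers of pi in S_Q, the ideals of the y such that
    y pi^k is in x S_Q would form a strictly increasing chain. *)
Let morph_decomp x : x != 0 -> exists u (k : nat), unit u /\ f x = u * pi ^+ k.
Proof.
move=> x0; have fx0 := morph_neq0 f_inj x0; apply: contrapT => nodec.
have Ox k : O (f x / pi ^+ k).
  elim: k => [|k IHk]; first by rewrite expr0 divr1; apply: local_ring_morph.
  have [uk|] := unit_or_div IHk.
    by case: nodec; exists (f x / pi ^+ k), k; rewrite mulfVK // expf_neq0.
  by rewrite exprSr invfM mulrA.
have [k||N LN] := @noetherian_chain S (fun k => [set y | O (f y * pi ^+ k / f x)]) noethS.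
- split=> [|y z Oy Oz|a y Oy] /=.
  + by rewrite rmorph0 !mul0r -(rmorph0 f); apply: local_ring_morph.
  + by rewrite rmorphD !mulrDl; apply: local_ringD.
  + rewrite rmorphM -!mulrA; apply: local_ringM; first exact: local_ring_morph.
    by rewrite mulrA.
- move=> k y /= Oy; rewrite exprSr mulrA mulrAC; exact: local_ringM.
have [y [s [Qs e]]] := Ox N.+1; have fs0 := notin_prime_neq0 f_inj Qs.
have : O (f y * pi ^+ N / f x).
  apply: (LN N.+1); rewrite /=.
  have -> : f y = f x / pi ^+ N.+1 * f s by rewrite e mulfVK.
  have -> : f x / pi ^+ N.+1 * f s * pi ^+ N.+1 / f x = f s.
    by field; rewrite fx0 expf_neq0.
  exact: local_ring_morph.
have -> : f y = f x / pi ^+ N.+1 * f s by rewrite e mulfVK.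
have -> : f x / pi ^+ N.+1 * f s * pi ^+ N / f x = f s / pi.
  by rewrite exprS; field; rewrite fx0 pi0 expf_neq0.
move=> Os; apply: OpiV; rewrite -[pi^-1](mulKf fs0).
by apply: local_ringM => //; apply: local_ringV.
Qed.

Let decomp z : z != 0 -> exists (k : int) u, unit u /\ z = u * pi ^ k.
Proof.
have [a [b [b0 ->]]] := f_frac z; have [->|a0] := eqVneq a 0.
  by rewrite rmorph0 mul0r eqxx.
have [u [k [uu ->]]] := morph_decomp a0; have [w [l [uw ->]]] := morph_decomp b0.
exists (k%:Z - l%:Z), (u / w); split; first by apply: unitM => //; apply: unitV.
by rewrite expfzDr // -invr_expz invfM mulrACA.
Qed.

Let decomp_inj u w (k l : int) : unit u -> unit w -> u * pi ^ k = w * pi ^ l -> k = l.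
Proof.
have le u' w' (k' l' : int) : unit u' -> unit w' -> u' * pi ^ k' = w' * pi ^ l' -> k' <= l'.
  move=> uu uw e; rewrite -subr_ge0; apply/(unit_pi_ge0 _ (unitM uw (unitV uu))).
  have [u0 w0] := (unit_neq0 uu, unit_neq0 uw).
  rewrite expfzDr // -invr_expz mulrACA -e -invfM divff; last first.
    by rewrite mulf_neq0 // expfz_neq0.
  by rewrite -(rmorph1 f); apply: local_ring_morph.
by move=> uu uw e; apply/eqP; rewrite eq_le (le _ _ _ _ uu uw e) (le _ _ _ _ uw uu (esym e)).
Qed.

Definition uniformizer_val (z : K) : \bar int :=
  if z == 0 then +oo%E else (xget 0 [set k : int | exists u, unit u /\ z = u * pi ^ k])%:E.
Local Notation v := uniformizer_val.

Let vE u (k : int) : unit u -> v (u * pi ^ k) = k%:E.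
Proof.
move=> uu; rewrite /v mulf_eq0 expfz_eq0 (negPf pi0) andbF orbF (negPf (unit_neq0 uu)).
case: xgetP => [l _ [w [uw e]]|/(_ k)[]//]; last by exists u.
by rewrite (decomp_inj uu uw e).
Qed.

Lemma uniformizer_val_ring : valuation_ring v = O.
Proof.
apply/seteqP; split=> z; rewrite /valuation_ring /=; have [->|z0] := eqVneq z 0.
- by move=> _; rewrite -(rmorph0 f); apply: local_ring_morph.
- have [k [u [uu ->]]] := decomp z0.
  by rewrite vE // lee_fin => k0; apply/(unit_pi_ge0 _ uu).
- by rewrite /v eqxx.
- have [k [u [uu ->]]] := decomp z0.
  by rewrite vE // lee_fin => /(unit_pi_ge0 _ uu).
Qed.

Let vM x y : v (x * y) = (v x + v y)%E.
Proof.
have [->|x0] := eqVneq x 0.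
  by rewrite mul0r /v eqxx; case: ifP.
have [->|y0] := eqVneq y 0.
  by rewrite mulr0 /v eqxx; case: ifP.
have [k [u [uu ->]]] := decomp x0; have [l [w [uw ->]]] := decomp y0.
by rewrite mulrACA -expfzDr // !vE //; apply: unitM.
Qed.

(** The ultrametric inequality reduces to the fact that S_Q is closed under
    addition: if v(x) <= v(y), then x + y = x (1 + y / x) with y / x in S_Q. *)
Lemma uniformizer_val_normalized : normalized_valuation v.
Proof.
have v0 x : v x = +oo%E <-> x = 0.
  by rewrite /v; case: eqP.
have vNy x : v x <> -oo%E by rewrite /v; case: ifP.
split=> //; last first.
  exists pi; rewrite -[pi]mul1r -[pi]expr1z vE //.
  exists 1, 1; rewrite rmorph1 divr1; split=> //; exact: prime_proper.
have le_vD x y : x != 0 -> (v x <= v y)%E -> (v x <= v (x + y)%R)%E.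
  move=> x0 xy; have -> : x + y = x * (1 + y / x).
    by rewrite mulrDr mulr1 mulrCA divff // mulr1.
  have Oyx : O (y / x).
    have [->|y0] := eqVneq y 0; first by rewrite mul0r -(rmorph0 f); apply: local_ring_morph.
    move: xy; have [k [u [uu ->]]] := decomp x0; have [l [w [uw ->]]] := decomp y0.
    rewrite !vE // lee_fin -subr_ge0 => kl.
    rewrite invfM mulrACA invr_expz -expfzDr //.
    by apply/(unit_pi_ge0 _ (unitM uw (unitV uu))).
  have : valuation_ring v (1 + y / x).
    rewrite uniformizer_val_ring; apply: local_ringD => //.
    by rewrite -(rmorph1 f); apply: local_ring_morph.
  by rewrite /valuation_ring /= vM; case: (v x) (v (1 + _)) => [r| |] [t| |] //=;
    rewrite -?EFinD ?lee_fin ?leey ?leNye // lerDl.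
move=> x y; have [->|x0] := eqVneq x 0; first by rewrite add0r ge_min lexx orbT.
have [->|y0] := eqVneq y 0; first by rewrite addr0 ge_min lexx.
have [xy|/ltW yx] := leP (v x) (v y); first exact: le_vD.
by rewrite addrC; apply: le_vD.
Qed.

End ValuationOfUniformizer.

(** * Lengths of localizations *)

Section LocalizationMap.
Local Open Scope quotient_scope.
Variables (A : comNzRingType) (P : prime_ideal A).

Definition to_loc (a : A) : localization P :=
  \pi_(localization P) (Localization.Fracs (fval := (a, 1)) (Localization.prime1 P)).

Lemma to_locD : {morph to_loc : a b / a + b}.
Proof.
move=> a b; rewrite -[RHS]Localization.pi_add; apply: Localization.eqmod => /=.
by rewrite !mulr1.
Qed.

Lemma to_locM : {morph to_loc : a b / a * b}.
Proof.
move=> a b; rewrite -[RHS]Localization.pi_mul; apply: Localization.eqmod => /=.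
by rewrite !mulr1.
Qed.

Lemma to_loc0 : to_loc 0 = 0.
Proof. by rewrite /to_loc -[RHS]/(Localization.zero P); unlock Localization.zero. Qed.

Lemma to_loc1 : to_loc 1 = 1.
Proof. by rewrite /to_loc -[RHS]/(Localization.one P); unlock Localization.one. Qed.

Lemma to_loc_eq a b : to_loc a = to_loc b -> exists2 u, ~ prime_set P u & u * (a - b) = 0.
Proof.
move=> /eqP/Localization.equivP[u Pu e]; exists u; first by rewrite -notin_setE.
by move: e; rewrite /= !mulr1.
Qed.

Lemma to_loc_unit s : ~ prime_set P s -> exists z, to_loc s * z = 1.
Proof.
rewrite -notin_setE => Ps.
exists (\pi_(localization P) (Localization.Fracs (fval := (1, s)) Ps)).
rewrite -to_loc1 -[LHS]Localization.pi_mul; apply: Localization.eqmod => /=.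
by rewrite !mulr1 !mul1r.
Qed.

Lemma to_loc_frac (z : localization P) :
  exists a s, ~ prime_set P s /\ z * to_loc s = to_loc a.
Proof.
elim/quotW: z => x; exists (Localization.fval x).1, (Localization.fval x).2.
split; first by rewrite -notin_setE; apply: Localization.fvalP.
rewrite -[LHS]Localization.pi_mul; apply: Localization.eqmod => /=.
by rewrite !mulr1.
Qed.

End LocalizationMap.

(** For P a prime of the quotient G of S by an ideal, and Q its preimage, the ideals
    of the localization of G at P correspond to the ideals of the valuation ring
    S_Q that contain the kernel. *)
Section LocalizationLength.
Variables (S G : comNzRingType) (h : {rmorphism S -> G}).
Variables (K : fieldType) (f : {rmorphism S -> K}).
Variables (P : prime_ideal G) (Q : prime_ideal S) (v : K -> \bar int).
Hypothesis h_surj : forall y, exists x, h x = y.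
Hypothesis f_inj : injective f.
Hypothesis PQ : forall x, prime_set Q x <-> prime_set P (h x).
Hypothesis v_norm : normalized_valuation v.
Hypothesis v_ring : valuation_ring v = local_ring f Q.

Let l x := to_loc P (h x).

Let lD : {morph l : x y / x + y}. Proof. by move=> x y; rewrite /l rmorphD to_locD. Qed.
Let lM : {morph l : x y / x * y}. Proof. by move=> x y; rewrite /l rmorphM to_locM. Qed.
Let l0 : l 0 = 0. Proof. by rewrite /l rmorph0 to_loc0. Qed.
Let l1 : l 1 = 1. Proof. by rewrite /l rmorph1 to_loc1. Qed.

Let l_unit s : ~ prime_set Q s -> exists z, l s * z = 1.
Proof. by move=> Qs; apply: to_loc_unit; rewrite -PQ. Qed.

Let l_frac z : exists x s, ~ prime_set Q s /\ z * l s = l x.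
Proof.
have [a [t [Pt e]]] := to_loc_frac z.
have [x xa] := h_surj a; have [s st] := h_surj t.
by exists x, s; rewrite /l xa st PQ st.
Qed.

Lemma val_local z : (0 <= v z)%E <-> local_ring f Q z.
Proof. by rewrite -v_ring. Qed.

Lemma val_morph_ge0 x : (0 <= v (f x))%E.
Proof. by apply/val_local; apply: local_ring_morph. Qed.

Lemma val_notin_prime s : ~ prime_set Q s -> v (f s) = 0%E.
Proof.
move=> Qs; apply/eqP; rewrite eq_le val_morph_ge0 andbT.
have fs0 := notin_prime_neq0 f_inj Qs.
have /val_local := local_ringV f Qs.
by rewrite nvalV // (nval_fin v_norm fs0) -EFinN !lee_fin oppr_ge0.
Qed.

Lemma val_le_divides x y : f x != 0 -> (v (f x) <= v (f y))%E ->
  exists a s, ~ prime_set Q s /\ y * s = x * a.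
Proof.
move=> fx0; rewrite -(nval_ge0_div v_norm _ fx0) => /val_local[a [s [Qs e]]].
exists a, s; split=> //; apply: f_inj; rewrite !rmorphM.
have fs0 := notin_prime_neq0 f_inj Qs.
by rewrite -[f y](divfK fx0) e; field.
Qed.

Lemma val_uniformizer : exists q, v (f q) = 1%E.
Proof.
have [z vz] : exists z, v z = 1%E by case: v_norm.
have /val_local[a [s [Qs zE]]] : (0 <= v z)%E by rewrite vz lee_fin.
exists a; have fs0 := notin_prime_neq0 f_inj Qs.
by rewrite -[f a](divfK fs0) -zE nvalM // vz val_notin_prime // adde0.
Qed.

Variables (x0 : S) (N : nat).
Hypothesis hx0 : h x0 = 0.
Hypothesis vx0 : v (f x0) = (N%:Z)%:E.
Hypothesis v_ker : forall x, h x = 0 -> ((N%:Z)%:E <= v (f x))%E.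

(** The image in G_P of the elements of S_Q of value at least k. *)
Let val_ideal (k : nat) : set (localization P) :=
  [set z | exists x s, [/\ ~ prime_set Q s, z * l s = l x & ((k%:Z)%:E <= v (f x))%E]].

Let val_ideal_ideal k : is_ideal (val_ideal k).
Proof.
split=> [|y z [a [s [Qs ys ka]]] [b [t [Qt zt kb]]]|y z [a [s [Qs zs ka]]]].
- exists 0, 1; split; first exact: prime_proper.
    by rewrite l0 mul0r.
  by rewrite rmorph0 nval0 // leey.
- exists (a * t + b * s), (s * t); split; first exact: notin_primeM.
    by rewrite lD !lM -ys -zt; ring.
  rewrite rmorphD !rmorphM; apply: nvalD => //; rewrite nvalM //.
    by rewrite (val_notin_prime Qt) adde0.
  by rewrite (val_notin_prime Qs) adde0.
- have [b [t [Qt yt]]] := l_frac y.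
  exists (b * a), (t * s); split; first exact: notin_primeM.
    by rewrite !lM -yt -zs; ring.
  rewrite rmorphM nvalM //; apply: le_trans ka _; apply: leeDr; exact: val_morph_ge0.
Qed.

(** The bound k <= N makes the value condition independent of the
    representative, since the kernel of h consists of elements of value at least
    N. *)
Let val_ideal_mem k x : (k <= N)%N -> val_ideal k (l x) -> ((k%:Z)%:E <= v (f x))%E.
Proof.
move=> kN [a [s [Qs e ka]]]; move: e; rewrite -lM => /to_loc_eq[u' Pu].
have [u uE] := h_surj u'; rewrite -{}uE in Pu *.
have {Pu}Qu : ~ prime_set Q u by rewrite PQ.
rewrite -rmorphB -rmorphM => /v_ker; rewrite rmorphM nvalM // (val_notin_prime Qu) add0e.
move=> Nd; have -> : v (f x) = v (f (x * s)).
  by rewrite rmorphM nvalM // (val_notin_prime Qs) adde0.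
rewrite -[x * s](subrK a) rmorphD; apply: nvalD => //.
by apply: le_trans Nd; rewrite lee_fin.
Qed.

(** Upper bound: along a strict chain of ideals of G_P, starting from x0, each new
    ideal contains an element that is not a multiple of the current witness, so
    its value is strictly smaller; starting at N, the values can drop at most N
    times. Lower bound: the ideals of the elements of value at least N - i form
    a chain, and the powers of an element of value 1 show that it is strict. *)
Lemma localization_length (R : realType) : ring_length (localization P) R = (N%:R)%:E.
Proof.
apply/eqP; rewrite eq_le; apply/andP; split.
  apply: ge_ereal_sup => _ [k [J [Ji JS]] <-].
  rewrite lee_fin ler_nat.
  have step i : (i <= k)%N -> exists x, J i (l x) /\ (v (f x) + (i%:Z)%:E <= (N%:Z)%:E)%E.
    elim: i => [_|i IHi ltik].
      exists x0; rewrite vx0 adde0 lexx; split=> //.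
      by rewrite /l hx0 to_loc0; case: (Ji 0%N isT).
    have [x [Jx vx]] := IHi (ltnW ltik).
    have [z [nJz Jz]] : exists z, ~ J i z /\ J i.+1 z.
      have [_] := JS _ ltik; apply: contra_notP => noz z Jz.
      by apply: contrapT => nJz; apply: noz; exists z.
    have [_ _ JM] := Ji _ (ltnW ltik); have [_ _ JM'] := Ji _ ltik.
    have [y [s [Qs ys]]] := l_frac z.
    exists y; split; first by rewrite -ys mulrC; apply: JM'.
    have fx0 : f x != 0.
      by apply/eqP => e; move: vx; rewrite e nval0.
    have [xy|yx] := leP (v (f x)) (v (f y)).
      exfalso; apply: nJz; have [a [t [Qt e]]] := val_le_divides fx0 xy.
      have [s' ss'] := l_unit Qs; have [t' tt'] := l_unit Qt.
      have -> : z = s' * t' * l a * l x.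
        have -> : z = z * l s * s' * (l t * t') by rewrite -(mulrA z) ss' tt' !mulr1.
        rewrite ys; have -> : l y * s' * (l t * t') = s' * t' * l (y * t) by rewrite lM; ring.
        by rewrite e lM; ring.
      exact: JM.
    have fy0 : f y != 0.
      by apply/eqP => e; move: yx; rewrite e nval0 // ltNge leey.
    move: yx vx; rewrite (nval_fin v_norm fx0) (nval_fin v_norm fy0).
    rewrite -!EFinD !lee_fin !lte_fin; lia.
  have [x [_]] := step k (leqnn k).
  have := val_morph_ge0 x; case: (v (f x)) => [r| |] //.
  by rewrite -EFinD !lee_fin; lia.
apply: ereal_sup_ubound; exists N => //.
have [q vq] := val_uniformizer.
have vqX k : v (f (q ^+ k)) = (k%:Z)%:E.
  elim: k => [|k IHk]; first by rewrite rmorph1 nval1.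
  by rewrite exprS rmorphM nvalM // vq IHk -EFinD intS.
exists (fun i => val_ideal (N - i)); split=> [i _|i ltiN]; first exact: val_ideal_ideal.
split=> [z [x [s [Qs e kx]]]|sub].
  by exists x, s; split=> //; apply: le_trans kx; rewrite lee_fin; lia.
have /sub : val_ideal (N - i.+1) (l (q ^+ (N - i.+1))).
  by exists (q ^+ (N - i.+1)), 1; rewrite l1 mulr1 vqX; split=> //; exact: prime_proper.
by move/(val_ideal_mem (leq_subr _ _)); rewrite vqX lee_fin; lia.
Qed.

End LocalizationLength.

(** * The normalized Rees ring of a normal ideal *)

Section ReesOfNormal.
Variables (D : idomainType) (I : set D).
Hypothesis normI : normal_ideal I.
Local Notation S := (rees_closure I).
Local Notation K := {fraction {poly D}}.
Local Notation ext := (extended_ideal I).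

Lemma rees_valD (x y : S) : val (x + y) = val x + val y. Proof. exact: rmorphD. Qed.
Lemma rees_valM (x y : S) : val (x * y) = val x * val y. Proof. exact: rmorphM. Qed.
Lemma rees_val0 : val (0 : S) = 0. Proof. exact: rmorph0. Qed.
Lemma rees_val1 : val (1 : S) = 1. Proof. exact: rmorph1. Qed.
Lemma rees_valX (x : S) k : val (x ^+ k) = val x ^+ k. Proof. exact: rmorphXn. Qed.
Lemma rees_val_sum n (y : 'I_n -> S) : val (\sum_i y i) = \sum_i val (y i).
Proof. exact: rmorph_sum. Qed.

Lemma rees_closureP (p : {poly D}) :
  p \in rees_closure_pred I <-> forall j, ideal_exp I j p`_j.
Proof.
split=> [/asboolP Ip [|j]|Ip]; first by [].
  by rewrite -(normI (ltn0Sn j)).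
apply/asboolP => -[|j]; last by rewrite (normI (ltn0Sn j)).
exists 1%N, (fun=> - p`_0); split=> // [i|]; last first.
  by rewrite big_nat1 subnn expr0 mulr1 expr1 subrr.
rewrite -eqn_leq => /eqP <-.
by rewrite ideal_expS ideal_mul1 //; exact: setT_ideal.
Qed.

Lemma rees_closure_coef (x : S) j : ideal_exp I j (val x)`_j.
Proof. by have /rees_closureP := valP x. Qed.

Lemma rees_closure_lift (p : {poly D}) :
  (forall j, ideal_exp I j p`_j) -> exists x : S, val x = p.
Proof. by move/rees_closureP => Ip; exists (ReesClosure Ip). Qed.

Lemma rees_monomial a j : ideal_exp I j a -> exists x : S, val x = a *: 'X^j.
Proof.
move=> Ia; apply: rees_closure_lift => k; rewrite coefZ coefXn.
by case: eqP => [->|_]; rewrite ?mulr1 // mulr0; case: (exp_ideal I k).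
Qed.

Lemma rees_const a : exists x : S, val x = a%:P.
Proof.
have [x xE] := @rees_monomial a 0 Logic.I.
by exists x; rewrite xE expr0 -mul_polyC mulr1.
Qed.

Lemma homogeneous_part_ideal (J : set S) j : is_ideal J ->
  is_ideal [set a | exists2 x, J x & val x = a *: 'X^j].
Proof.
move=> [J0 JD JM]; split=> [|a b [x Jx xE] [y Jy yE]|a b [x Jx xE]].
- by exists 0; rewrite // rees_val0 scale0r.
- by exists (x + y); [apply: JD|rewrite rees_valD xE yE scalerDl].
- have [c cE] := rees_const a; exists (c * x); first exact: JM.
  by rewrite rees_valM cE xE mul_polyC scalerA.
Qed.

Lemma sum_homogeneous (J : set S) (x : S) : is_ideal J ->
  (forall j, exists2 y, J y & val y = (val x)`_j *: 'X^j) -> J x.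
Proof.
move=> iJ xJ; have /choice[y yP] j : exists y, J y /\ val y = (val x)`_j *: 'X^j.
  by have [y Jy yE] := xJ j; exists y.
have -> : x = \sum_(j < size (val x)) y j.
  apply: val_inj; rewrite rees_val_sum -[LHS]coefK poly_def.
  by apply: eq_bigr => j _; case: (yP j) => _ ->.
by apply: ideal_sum => // j _; case: (yP j).
Qed.

Lemma extended_idealP (x : S) : ext x <-> forall j, ideal_exp I j.+1 (val x)`_j.
Proof.
split.
  suff sub : ext `<=` [set y : S | forall j, ideal_exp I j.+1 (val y)`_j] by apply: sub.
  apply: ideal_span_sub => [|y [a Ia yE] j].
    split=> [j|y z Iy Iz j|y z Iz j].
    - by rewrite rees_val0 coef0; case: (exp_ideal I j.+1).
    - by rewrite rees_valD coefD; case: (exp_ideal I j.+1) => _ + _; apply.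
    - rewrite rees_valM coefM; apply: ideal_sum (exp_ideal _ _) _ => i _.
      rewrite -[X in ideal_exp I X.+1](subnKC (leq_ord i)) -addnS.
      by apply: ideal_exp_mulr => //; apply: rees_closure_coef.
  rewrite yE coefC; case: eqP => [->|_]; last by case: (exp_ideal I j.+1).
  by rewrite ideal_expS -[a]mulr1; apply: ideal_mul_mem.
move=> Ix; apply: sum_homogeneous; first exact: span_ideal.
move=> j; suff sub : ideal_exp I j.+1 `<=`
    [set a | exists2 y : S, ext y & val y = a *: 'X^j] by apply: sub.
apply: ideal_mul_sub; first exact: homogeneous_part_ideal (span_ideal _).
move=> a b Ia Ib.
have [y yE] := rees_const a; have [z zE] := rees_monomial Ib.
exists (z * y); last by rewrite rees_valM yE zE mulrC mul_polyC scalerA.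
have [_ _ eM] := span_ideal [set p : S | exists2 f, I f & val p = f%:P].
by apply: eM; apply: subset_ideal_span; exists a.
Qed.

(** If I is generated by s_0, ..., s_(r-1), then D[It] is the image of the
    morphism from D[y_0, ..., y_(r-1)] to D[t] that maps y_i to s_i t. *)
Lemma noetherian_rees_closure : noetherian D -> is_ideal I -> noetherian S.
Proof.
move=> noethD iI; have [s sE] := noethD I iI.
pose g : {rmorphism mpoly (size s) D -> {poly D}} :=
  mmap (@polyC D) (fun i => s`_i *: 'X).
have gC c : g (mpolyC _ c) = c%:P by apply: mmapC.
have gX i : g (mpolyX D (mnm1 i)) = s`_i *: 'X by rewrite /g /= mmapX mmap1U.
have gS a : exists x : S, val x = g a.
  apply: rees_closure_lift; apply/rees_closureP; rewrite /g /= /mmap.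
  apply: rpred_sum => m _; apply: rpredM.
    by have [x <-] := rees_const (mcoeff m a); apply: valP.
  apply: rpred_prod => i _; apply: rpredX.
  have [|x <-] := @rees_monomial s`_i 1; last exact: valP.
  rewrite ideal_expS ideal_mulC ideal_mul1 // sE; apply: subset_ideal_span.
  by rewrite /= mem_nth.
apply: (@noetherian_image (mpoly (size s) D) _ _ g val val_inj gS) => [x|]; last first.
  exact: noetherian_mpoly.
pose L j := [set a | exists p, g p = a *: 'X^j].
have iL j : is_ideal (L j).
  split=> [|a b [p pE] [q qE]|a b [p pE]]; rewrite /L /=.
  - by exists 0; rewrite rmorph0 scale0r.
  - by exists (p + q); rewrite rmorphD pE qE scalerDl.
  - by exists (mpolyC _ a * p); rewrite rmorphM pE gC mul_polyC scalerA.
have IL j : ideal_exp I j `<=` L j.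
  elim: j => [a _|j IHj]; first by exists (mpolyC _ a); rewrite gC expr0 alg_polyC.
  apply: ideal_mul_sub => // a b Ia /IHj[p pE].
  have [q qE] : L 1%N a.
    move: Ia; rewrite sE; apply: ideal_span_sub => // c /= cs.
    have lti : (index c s < size s)%N by rewrite index_mem.
    by exists (mpolyX D (mnm1 (Ordinal lti))); rewrite gX /= nth_index.
  by exists (q * p); rewrite rmorphM qE pE -scalerAl -scalerAr scalerA -exprD.
have /choice[p pE] j : L j (val x)`_j by apply/IL/rees_closure_coef.
exists (\sum_(j < size (val x)) p j); rewrite rmorph_sum -[RHS]coefK poly_def.
by apply: eq_bigr => j _; rewrite pE.
Qed.

Definition rees_frac : {rmorphism S -> K} := @tofrac {poly D} \o val.

Lemma rees_frac_inj : injective rees_frac.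
Proof. by move=> x y /tofrac_inj/val_inj. Qed.

(** A power of a nonzero element g of I maps any polynomial into the Rees ring: if
    p has degree less than m, then g^m p_j is in I^j for all j. *)
Lemma rees_fracP g (z : K) : I g -> g != 0 ->
  exists a b, b != 0 /\ z = rees_frac a / rees_frac b.
Proof.
move=> Ig g0; have [a [b [b0 ->]]] := fractionP z.
have gX k : ideal_exp I k (g ^+ k).
  by elim: k => // k IHk; rewrite exprS; apply: ideal_mul_mem.
have gP (p : {poly D}) m : (size p <= m)%N -> exists x : S, val x = (g ^+ m)%:P * p.
  move=> szp; apply: rees_closure_lift => j; rewrite coefCM.
  have [ltjm|lemj] := ltnP j m.
    rewrite -(subnKC (ltnW ltjm)) exprD -mulrA mulrC.
    by case: (exp_ideal I j) => _ _ /(_ _ _ (gX j)); apply.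
  by rewrite nth_default ?mulr0 ?(leq_trans szp) //; case: (exp_ideal I j).
have [x xE] := gP a _ (leq_maxl (size a) (size b)).
have [y yE] := gP b _ (leq_maxr (size a) (size b)).
have gm0 : (g ^+ maxn (size a) (size b))%:P != 0 :> {poly D}.
  by rewrite polyC_eq0 expf_neq0.
exists x, y; split.
  by apply: contraNneq b0 => y0; move/eqP: yE; rewrite y0 rees_val0 eq_sym mulf_eq0 (negPf gm0).
by rewrite /rees_frac /= xE yE !rmorphM -mulf_div divff ?mul1r // tofrac_eq0.
Qed.

(** Normality of D[t] puts the fraction in D[t]; [integral_coefX] makes its
    homogeneous parts p_j t^j integral over S, which means that p_j is integral
    over the ideal I^j. *)
Lemma rees_closure_normal (a b : S) : normal_domain {poly D} ->
  (forall m : nat, m.+1%:R \is a @GRing.unit D) -> b != 0 ->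
  integralOver rees_frac (rees_frac a / rees_frac b) ->
  exists c, rees_frac a / rees_frac b = rees_frac c.
Proof.
move=> normD natD b0 [q q_mon qz].
have b0' : val b != 0 by rewrite -(inj_eq val_inj) rmorph0 in b0.
have [|p pE] := @normal_domain_integral _ _ (@tofrac {poly D}) (val a) (val b)
  (@tofrac_inj _) normD b0'.
  exists (map_poly val q); first by rewrite monic_map.
  by rewrite -map_poly_comp.
have intp : integralOver (val : S -> {poly D}) p.
  exists q => //; move: qz; rewrite /rees_frac /= pE map_poly_comp /=.
  by rewrite !rootE horner_map tofrac_eq0.
have [|x xE] := @rees_closure_lift p; last by exists x; rewrite pE /rees_frac /= xE.
move=> j; have : integralOver (val : S -> {poly D}) (p`_j *: 'X^j).
  apply: (@integral_coefX S D val) intp => [m|x].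
    have [x xE] := rees_const (m.+1%:R^-1); exists x; rewrite [X in X * _]xE.
    by rewrite -(rmorph_nat (@polyC D)) -polyCM mulVr.
  apply: rees_closure_lift => i; rewrite coef_scaleX.
  by case: (exp_ideal I i) => _ _; apply; apply: rees_closure_coef.
move/(integral_monomial rees_closure_coef rees_closure_lift).
by case: j => // j; rewrite (normI (ltn0Sn j)).
Qed.

End ReesOfNormal.

Section GradedRing.
Local Open Scope quotient_scope.

(** As S is the Rees ring, gr_I(D) is its quotient by the elements whose
    coefficients lie one power of I deeper; these form the ideal IS. *)
Lemma gr_presentation (D : idomainType) (I : idealr D) : normal_ideal [set` I] ->
  exists h : {rmorphism rees_closure [set` I] -> gr I},
    (forall y, exists x, h x = y) /\ (forall x, h x = 0 <-> extended_ideal [set` I] x).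
Proof.
move=> normI; pose S := rees_closure [set` I].
have /choice[c cE] (x : S) : exists y : rees [set` I], val y = val x.
  by apply: rees_surj; apply: rees_closure_coef.
pose h (x : S) : gr I := \pi_({ideal_quot (gr_ideal (I := I) : idealr (rees [set` I]))}) (c x).
have cB x y : c (x - y) = c x - c y.
  apply: val_inj; rewrite cE; transitivity (val (c x) - val (c y)); last by rewrite rmorphB.
  by rewrite !cE; apply: rmorphB.
have cM x y : c (x * y) = c x * c y.
  apply: val_inj; rewrite cE; transitivity (val (c x) * val (c y)); last by rewrite rmorphM.
  by rewrite !cE; apply: rmorphM.
have c1 : c 1 = 1 by apply: val_inj; rewrite cE; apply: etrans (esym (rmorph1 _)); apply: rmorph1.
have hB : zmod_morphism h by move=> x y; rewrite /h cB; apply: rmorphB.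
have hM : monoid_morphism h.
  by rewrite /h; split=> [|x y]; rewrite ?c1 ?cM; [apply: rmorph1|apply: rmorphM].
pose hR : {rmorphism S -> gr I} := HB.pack h
  (GRing.isZmodMorphism.Build S (gr I) h hB) (GRing.isMonoidMorphism.Build S (gr I) h hM).
exists hR; split=> [y|x].
  have [x xE] : exists x : S, val x = val (repr y).
    by apply: rees_closure_lift => // j; apply: reesP.
  exists x; rewrite -[RHS]reprK; congr (\pi _); apply: val_inj.
  by rewrite cE.
rewrite extended_idealP //.
have -> : (hR x = 0) <-> c x \in gr_ideal (I := I).
  rewrite -[c x]subr0 Quotient.idealrBE; split=> [e|/eqP e].
    by apply/eqP; apply: etrans e _; rewrite rmorph0.
  by apply: etrans e _; rewrite rmorph0.
by split=> [/asboolP|] cx; [move=> j; rewrite -cE|apply/asboolP => j; rewrite cE].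
Qed.

End GradedRing.

(** * Minimal primes *)

Lemma prime_ideal_inj (A : comNzRingType) (P P' : prime_ideal A) :
  prime_set P = prime_set P' -> P = P'.
Proof.
case: P P' => [s si s1 sM] [t ti t1 tM] /= st; subst t.
by congr PrimeIdeal; apply: Prop_irrelevance.
Qed.

Lemma prime_ideal_exp (A : comNzRingType) (P : prime_ideal A) x m :
  prime_set P (x ^+ m) -> prime_set P x.
Proof.
elim: m => [/(prime_proper (p := P))//|m IHm].
by rewrite exprS => /prime_mulP[].
Qed.

Section PrimesOfQuotient.
Variables (S G : comNzRingType) (h : {rmorphism S -> G}).
Hypothesis h_surj : forall y, exists x, h x = y.

Lemma preimage_prime (P : prime_ideal G) :
  exists Q : prime_ideal S, prime_set Q = [set x | prime_set P (h x)].
Proof.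
have [P0 PD PM] := prime_is_ideal P.
have iQ : is_ideal [set x | prime_set P (h x)].
  split=> [|x y Px Py|a x Px] /=; rewrite ?rmorph0 ?rmorphD ?rmorphM //.
    exact: PD.
  exact: PM.
have Q1 : ~ [set x | prime_set P (h x)] 1 by rewrite /= rmorph1; apply: prime_proper.
have QM x y : [set x | prime_set P (h x)] (x * y) ->
    [set x | prime_set P (h x)] x \/ [set x | prime_set P (h x)] y.
  by rewrite /= rmorphM; apply: prime_mulP.
by exists (PrimeIdeal iQ Q1 QM).
Qed.

Lemma image_prime (Q : prime_ideal S) : (forall x, h x = 0 -> prime_set Q x) ->
  exists P : prime_ideal G, prime_set Q = [set x | prime_set P (h x)].
Proof.
move=> kerQ; have [Q0 QD QM] := prime_is_ideal Q.
pose J := [set y | exists2 x, prime_set Q x & h x = y].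
have Jh x : J (h x) <-> prime_set Q x.
  split=> [[x' Qx' e]|Qx]; last by exists x.
  rewrite -[x](subrK x'); apply: QD => //; apply: kerQ.
  by rewrite rmorphB e subrr.
have iJ : is_ideal J.
  split=> [|y z [x Qx <-] [x' Qx' <-]|y z [x Qx <-]].
  - by exists 0; rewrite ?rmorph0.
  - by exists (x + x'); [apply: QD|rewrite rmorphD].
  - by have [a <-] := h_surj y; exists (a * x); [apply: QM|rewrite rmorphM].
have J1 : ~ J 1 by rewrite -(rmorph1 h) Jh; apply: prime_proper.
have JM y z : J (y * z) -> J y \/ J z.
  have [[a <-] [b <-]] := (h_surj y, h_surj z).
  by rewrite -rmorphM !Jh; apply: prime_mulP.
exists (PrimeIdeal iJ J1 JM); apply/seteqP; split=> x /=; by rewrite Jh.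
Qed.

Lemma minimal_prime_preimage (P : prime_ideal G) (Q : prime_ideal S) (J : set S) :
  (forall x, h x = 0 <-> J x) -> prime_set Q = [set x | prime_set P (h x)] ->
  minimal_prime_over [set 0] P <-> minimal_prime_over J Q.
Proof.
move=> kerJ QP; have [P0 _ _] := prime_is_ideal P.
have preim_inj (P' P'' : prime_ideal G) :
    [set x | prime_set P' (h x)] `<=` [set x | prime_set P'' (h x)] -> P' `<=` P''.
  by move=> sub y; have [x <-] := h_surj y; apply: sub.
split=> [[_ Pmin]|[_ Qmin]]; split.
- by move=> x /kerJ hx; rewrite QP /= hx.
- move=> Q' JQ' Q'Q; have [|P' Q'P'] := @image_prime Q'; first by move=> x /kerJ/JQ'.
  rewrite QP Q'P'; suff -> : P' = P :> set G by [].
  apply: Pmin => [_ ->|]; first by case: (prime_is_ideal P').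
  by apply: preim_inj; rewrite -QP -Q'P'.
- by move=> _ ->.
- move=> P' _ P'P; have [Q' Q'P'] := preimage_prime P'.
  have Q'Q : Q' = Q :> set S.
    apply: Qmin; last by rewrite Q'P' QP => x; apply: P'P.
    by move=> x /kerJ hx; rewrite Q'P' /= hx; case: (prime_is_ideal P').
  by apply/seteqP; split; apply: preim_inj; rewrite -QP -Q'P' Q'Q.
Qed.

End PrimesOfQuotient.

(** ** The minimal primes of IS do not contain It *)

Section NotIrrelevant.
Variables (D : idomainType) (I : set D).
Hypothesis normI : normal_ideal I.
Local Notation S := (rees_closure I).
Local Notation ext := (extended_ideal I).
(** The model for phi is f(x) |-> f(tx) on a polynomial ring: the coefficient of t^e
    in phi(f) is the homogeneous part of f of degree e. *)
Variable phi : {rmorphism D -> {poly D}}.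
Hypothesis phi_inj : injective phi.

(** The elements of order at least e. *)
Let F (e : nat) : set D := [set a | forall i, (i < e)%N -> (phi a)`_i = 0].

Let F_ideal e : is_ideal (F e).
Proof.
split=> [i _|a b Fa Fb i lt_ie|a b Fb i lt_ie]; first by rewrite rmorph0 coef0.
  by rewrite rmorphD coefD Fa // Fb // addr0.
rewrite rmorphM coefM big1 // => j _; rewrite Fb ?mulr0 //.
exact: leq_ltn_trans (leq_subr _ _) _.
Qed.

Let FM d e a b : F d a -> F e b ->
  F (d + e) (a * b) /\ (phi (a * b))`_(d + e) = (phi a)`_d * (phi b)`_e.
Proof.
move=> Fa Fb; split=> [i lti|]; rewrite rmorphM coefM.
  apply: big1 => j _; have [/Fa ->|ledj] := ltnP j d; first by rewrite mul0r.
  by rewrite Fb ?mulr0 //; have := ltn_ord j; lia.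
have ltd : (d < (d + e).+1)%N by lia.
rewrite (bigD1 (Ordinal ltd)) //= addKn big1 ?addr0 // => j nej.
have [/Fa ->|ledj] := ltnP j d; first by rewrite mul0r.
rewrite Fb ?mulr0 //; have : (j != d :> nat) by apply: contra nej => /eqP e'; apply/eqP/val_inj.
by have := ltn_ord j; lia.
Qed.

(** The prime ideal of the p in S such that p_j has no part of degree jd, for d the
    least order of an element of I, contains IS. If Q contained It, it would
    contain this prime too, because p_0 is in the radical of I, and would be equal
    to it by minimality; but at is not in this prime when a is in I and has
    order d. *)
Lemma minimal_prime_not_irrelevant (Q : prime_ideal S) g :
  I g -> g != 0 -> (forall a, I a -> (phi a)`_0 = 0) ->
  (forall a, (phi a)`_0 = 0 -> radical I a) ->
  minimal_prime_over ext Q ->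
  exists a (y : S), [/\ I a, val y = a *: 'X & ~ prime_set Q y].
Proof.
move=> Ig g0 I0 radI [extQ Qmin].
have exd : exists d, `[< exists2 a, I a & (phi a)`_d != 0 >].
  have phig : phi g != 0 by rewrite -(rmorph0 phi) (inj_eq phi_inj).
  exists (size (phi g)).-1; apply/asboolP; exists g => //.
  by rewrite -lead_coefE lead_coef_eq0.
case: (ex_minnP exd) => d /asboolP[a0 Ia0 phia0] dmin.
have IF j : ideal_exp I j `<=` F (j * d).
  elim: j => [|j IHj]; first by move=> a _ i.
  apply: ideal_mul_sub; first exact: F_ideal.
  move=> a b Ia /IHj Fb.
  rewrite mulSn; apply: (FM _ Fb).1 => i ltid; apply/eqP.
  apply: contraLR ltid => nz; rewrite -leqNgt; apply: dmin.
  by apply/asboolP; exists a.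
(* Elements of I^j have order at least jd; the map psi keeps the part of degree
   exactly jd of p_j, which makes it multiplicative. *)
pose psi (x : S) : {poly D} := \poly_(j < size (val x)) (phi (val x)`_j)`_(j * d).
have psiE x j : (psi x)`_j = (phi (val x)`_j)`_(j * d).
  by rewrite coef_poly; case: ltnP => // le; rewrite [(val x)`_j]nth_default // rmorph0 coef0.
have psiM x y : psi (x * y) = psi x * psi y.
  apply/polyP => j; rewrite coefM psiE rees_valM.
  rewrite coefM rmorph_sum coef_sum; apply: eq_bigr => i _; rewrite !psiE.
  have Fi := IF _ _ (rees_closure_coef normI x i).
  have Fj := IF _ _ (rees_closure_coef normI y (j - i)).
  by rewrite -(FM Fi Fj).2 -mulnDl subnKC // -ltnS.
have psiD x y : psi (x + y) = psi x + psi y.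
  by apply/polyP => j; rewrite coefD !psiE rees_valD coefD rmorphD coefD.
have iP : is_ideal [set x | psi x = 0].
  split=> [|x y /= x0 y0|x y /= y0] /=; last by rewrite psiM y0 mulr0.
    by apply/polyP => j; rewrite psiE rees_val0 !coef0 rmorph0 coef0.
  by rewrite psiD x0 y0 addr0.
have P1 : ~ [set x | psi x = 0] 1.
  move=> /(congr1 (fun p : {poly D} => p`_0)).
  rewrite psiE rees_val1 coef1 /= rmorph1 coef1 coef0 => /eqP.
  by rewrite oner_eq0.
have PM x y : [set x | psi x = 0] (x * y) -> [set x | psi x = 0] x \/ [set x | psi x = 0] y.
  by rewrite /= psiM => /eqP; rewrite mulf_eq0 => /orP[] /eqP; [left|right].
apply: contrapT => noa.
have [Q0 QD QM] := prime_is_ideal Q.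
have ItQ a (y : S) : I a -> val y = a *: 'X -> prime_set Q y.
  by move=> Ia yE; apply: contrapT => nQ; apply: noa; exists a, y.
have QP : [set x | psi x = 0] = prime_set Q.
  apply: (Qmin (PrimeIdeal iP P1 PM)) => /=.
    apply: ideal_span_sub => // x [a Ia xE] /=; apply/polyP => j.
    rewrite psiE xE coefC coef0; case: eqP => [->|_]; last by rewrite rmorph0 coef0.
    exact: I0.
  move=> x psix; apply: (sum_homogeneous (prime_is_ideal Q)) => -[|j].
    have := congr1 (fun p : {poly D} => p`_0) psix; rewrite psiE coef0 => /radI[m Im].
    have [y yE] := rees_const normI (val x)`_0; exists y; last by rewrite yE expr0 alg_polyC.
    apply: (@prime_ideal_exp _ Q y m); apply: extQ; apply: subset_ideal_span.
    exists ((val x)`_0 ^+ m) => //.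
    by rewrite rees_valX yE rmorphXn.
  suff sub : ideal_exp I j.+1 `<=` [set a | exists2 y : S, prime_set Q y & val y = a *: 'X^(j.+1)].
    by apply: sub; apply: rees_closure_coef.
  apply: ideal_mul_sub; first exact: homogeneous_part_ideal (prime_is_ideal Q).
  move=> a b Ia Ib; have [|y yE] := @rees_monomial _ _ normI a 1.
    by rewrite ideal_expS -[a]mulr1; apply: ideal_mul_mem.
  have [z zE] := rees_monomial normI Ib.
  exists (y * z); first by rewrite mulrC; apply: QM; apply: ItQ yE.
  rewrite rees_valM yE zE.
  by rewrite -scalerAl -scalerAr scalerA -exprD.
have [|y yE] := @rees_monomial _ _ normI a0 1.
  by rewrite ideal_expS -[a0]mulr1; apply: ideal_mul_mem.
have : prime_set Q y by apply: ItQ yE.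
rewrite -QP /= => /(congr1 (fun p : {poly D} => p`_1)).
by rewrite psiE yE coefZ coefXn eqxx mulr1 mul1n coef0 => /eqP; apply/negP.
Qed.

End NotIrrelevant.

(** * Rees valuations and the graded ring *)

Section ReesValuationOfPrime.
Variables (D : idomainType) (I : set D).
Hypothesis normI : normal_ideal I.
Local Notation S := (rees_closure I).
Local Notation f := (rees_frac I).
Local Notation ext := (extended_ideal I).
Variables (Q : prime_ideal S) (g : D) (y : S).
Hypothesis Ig : I g.
Hypothesis yE : val y = g *: 'X.
Hypothesis Qy : ~ prime_set Q y.

Let g0 : g != 0.
Proof.
apply: contra_notN Qy => /eqP g0; have -> : y = 0.
  by apply: val_inj; rewrite yE g0 scale0r rees_val0.
by case: (prime_is_ideal Q).
Qed.

Let const_ext a : I a -> exists2 x : S, ext x & val x = a%:P.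
Proof.
move=> Ia; have [x xE] := rees_const normI a; exists x => //.
by apply: subset_ideal_span; exists a.
Qed.

(** For a in I, the quotient a / g is the fraction of at by gt. *)
Let ext_locally_principal x0 (x : S) : val x0 = g%:P -> ext x -> local_ring f Q (f x / f x0).
Proof.
move=> x0E; have fx0 : f x0 = tofrac g%:P by rewrite /rees_frac /= [\val x0]x0E.
suff sub : ext `<=` [set x | local_ring f Q (f x / f x0)] by apply: sub.
apply: ideal_span_sub => [|z [a Ia zE]].
  split=> [|a b Oa Ob|a b Ob] /=.
  - by rewrite rmorph0 mul0r -(rmorph0 f); apply: local_ring_morph.
  - by rewrite rmorphD mulrDl; apply: local_ringD => //; apply: rees_frac_inj.
  - by rewrite rmorphM -mulrA; apply: local_ringM => //; apply: local_ring_morph.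
have [|w wE] := @rees_monomial _ _ normI a 1.
  by rewrite ideal_expS -[a]mulr1; apply: ideal_mul_mem.
exists w, y; split=> //; rewrite fx0 /rees_frac /= [\val z]zE [\val w]wE [\val y]yE.
rewrite -!mul_polyC !rmorphM -mulf_div divff ?mulr1 //.
by rewrite tofrac_eq0 polyX_eq0.
Qed.

Lemma minimal_prime_valuation : noetherian D -> normal_domain {poly D} ->
  (forall m : nat, m.+1%:R \is a @GRing.unit D) -> is_ideal I ->
  minimal_prime_over ext Q ->
  exists v, normalized_valuation v /\ valuation_ring v = local_ring f Q.
Proof.
move=> noethD normD natD iI minQ; have [x0 ex0 x0E] := const_ext Ig.
have noethS := noetherian_rees_closure normI noethD iI.
have x00 : x0 != 0.
  by apply: contraNneq g0 => x00; rewrite -polyC_eq0 -x0E x00 rees_val0.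
have [||q [Qq q0 qgen]] := local_uniformizer (@rees_frac_inj _ I) noethS _ minQ ex0 x00.
- by move=> a b; apply: rees_closure_normal.
- by move=> x; apply: ext_locally_principal.
have fracS z := rees_fracP normI z Ig g0.
exists (uniformizer_val f Q q); split.
  exact: (uniformizer_val_normalized (@rees_frac_inj _ I) noethS fracS).
exact: (uniformizer_val_ring (@rees_frac_inj _ I) noethS fracS).
Qed.

Variable v : {fraction {poly D}} -> \bar int.
Hypothesis v_norm : normalized_valuation v.
Hypothesis v_ring : valuation_ring v = local_ring f Q.

Lemma valuation_of_ideal_eq :
  valuation_of_ideal I v = v (tofrac g%:P) /\
  forall x, ext x -> (v (tofrac g%:P) <= v (f x))%E.
Proof.
have [x0 ex0 x0E] := const_ext Ig.
have fx0 : f x0 = tofrac g%:P by rewrite /rees_frac /= [\val x0]x0E.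
have gP0 : tofrac g%:P != 0 by rewrite tofrac_eq0 polyC_eq0.
have vext x : ext x -> (v (tofrac g%:P) <= v (f x))%E.
  move=> ex; rewrite -(nval_ge0_div v_norm) // -fx0.
  by apply/(val_local v_ring); apply: ext_locally_principal.
split=> //; have vI a : I a -> (v (tofrac g%:P) <= v (tofrac a%:P))%E.
  move=> Ia; have [x ex xE] := const_ext Ia.
  by have := vext x ex; rewrite /rees_frac /= [\val x]xE.
rewrite /valuation_of_ideal /valuation_min.
case: xgetP => [m _ [[_ [a Ia <-] <-] mmin]|/(_ (v (tofrac g%:P)))[]].
  by apply/eqP; rewrite eq_le vI // mmin //; exists g.
split; first by exists (tofrac g%:P) => //; exists g.
by move=> _ [a Ia <-]; apply: vI.
Qed.

(** The element x0 = g of IS has the least value v(I) among the elements of IS,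
    which is the kernel of h. *)
Lemma length_eq_valuation (R : realType) (G : comNzRingType) (h : {rmorphism S -> G})
    (P : prime_ideal G) :
  (forall z, exists x, h x = z) -> (forall x, h x = 0 <-> ext x) ->
  prime_set Q = [set x | prime_set P (h x)] ->
  ring_length (localization P) R =
    er_map (fun z : int => z%:~R : R) (valuation_of_ideal I v).
Proof.
move=> h_surj kerh QP; have [-> vext] := valuation_of_ideal_eq.
have [x0 ex0 x0E] := const_ext Ig.
have fx0 : f x0 = tofrac g%:P by rewrite /rees_frac /= [\val x0]x0E.
have gP0 : tofrac g%:P != 0 by rewrite tofrac_eq0 polyC_eq0.
have [N vN] : exists N : nat, v (f x0) = (N%:Z)%:E.
  have := val_morph_ge0 v_ring x0; rewrite fx0 (nval_fin v_norm gP0) lee_fin.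
  by case: (fine _) => // N _; exists N.
rewrite -fx0 vN.
rewrite (@localization_length _ _ h _ f P Q v h_surj (@rees_frac_inj _ I) _ v_norm v_ring x0 N) //.
- by move=> x; rewrite QP.
- by apply/kerh.
- by move=> x /kerh/vext; rewrite -vN fx0.
Qed.

End ReesValuationOfPrime.

Lemma local_ring_prime (S : comNzRingType) (K : fieldType) (f : {rmorphism S -> K})
    (Q Q' : prime_ideal S) : injective f ->
  local_ring f Q = local_ring f Q' -> prime_set Q = prime_set Q'.
Proof.
move=> f_inj QQ'.
suff sub P P' : local_ring f P = local_ring f P' -> prime_set P `<=` prime_set P'.
  by apply/seteqP; split; apply: sub.
move=> PP' x Px; have [->|x0] := eqVneq x 0; first by case: (prime_is_ideal P').
apply: contrapT => P'x; apply: (local_ring_inv_prime f_inj Px (morph_neq0 f_inj x0)).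
by rewrite PP'; apply: local_ringV.
Qed.

Section OriginIdeal.
Variables (n : nat) (k : idomainType).
Local Notation D := (mpoly n k).
Local Notation m := (origin_ideal n k).

(** The substitution f(x) |-> f(tx): the coefficient of t^e is the homogeneous part
    of degree e. *)
Definition grading_morph : {rmorphism D -> {poly D}} :=
  mmap (@polyC D \o @mpolyC n k) (fun i => mpolyX k (mnm1 i) *: 'X).

Lemma grading_morphX i : grading_morph (mpolyX k (mnm1 i)) = mpolyX k (mnm1 i) *: 'X.
Proof. by rewrite /grading_morph /= mmapX mmap1U. Qed.

Lemma grading_morphC c : grading_morph (mpolyC n c) = (mpolyC n c)%:P.
Proof. exact: mmapC. Qed.

(** Evaluation at t = 1 is a left inverse. *)
Lemma grading_morph_inj : injective grading_morph.
Proof.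
apply: (@can_inj _ _ _ (horner_eval 1)) => p.
apply: (mpoly_morph_eq (f := horner_eval 1 \o grading_morph) (g := idfun)) => [c|i] /=.
  by rewrite grading_morphC /horner_eval hornerC.
by rewrite grading_morphX /horner_eval hornerZ hornerX mulr1.
Qed.

Lemma origin_idealP p : m p <-> (grading_morph p)`_0 = 0.
Proof.
move: grading_morphX grading_morphC; move: grading_morph => phi phiX phiC.
have sub : m `<=` [set p | (phi p)`_0 = 0].
  apply: ideal_span_sub => [|_ [i _ <-]] /=; last first.
    by rewrite phiX coefZ coefX mulr0.
  split=> [|a b /= a0 b0|a b /= b0] /=; first by rewrite rmorph0 coef0.
    by rewrite rmorphD coefD a0 b0 addr0.
  by rewrite rmorphM coefM big_ord1 b0 mulr0.
split; first exact: sub.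
have [m0 mD mM] : is_ideal m by apply: span_ideal.
have [c mc] : exists c, m (p - mpolyC n c).
  elim/mpolyind: p => [|c mn p _ _ [c' IHp]]; first by exists 0; rewrite rmorph0 subr0.
  have [mn0|] := eqVneq mn mnm0.
    exists (c + c'); rewrite mn0 -mul_mpolyC mpolyX0 mulr1 rmorphD /=.
    by rewrite opprD addrACA subrr add0r.
  move=> mn0; exists c'; rewrite -addrA; apply: mD => //.
  have [i mni] : exists i, mn i != 0%N.
    apply/existsP; apply: contraNT mn0; rewrite negb_exists => /forallP mn0.
    by apply/eqP/mnmP => i; rewrite mnm0E; apply/eqP; have := mn0 i; rewrite negbK.
  have -> : mn = mnm_add (mnm_sub mn (mnm1 i)) (mnm1 i).
    rewrite submK //; apply/mnm_lepP => j; rewrite mnm1E.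
    by case: eqP => [<-|//]; rewrite lt0n.
  rewrite -mul_mpolyC mpolyXD mulrA; apply: mM.
  by apply: subset_ideal_span; exists i.
have := sub _ mc; rewrite /= rmorphB coefB phiC coefC /= => + p0.
rewrite p0 sub0r => /eqP; rewrite oppr_eq0 => /eqP c0.
by rewrite -[p]subr0 -c0.
Qed.

End OriginIdeal.

(** * Behrend's number of a normal ideal *)

(** What the proof uses of a polynomial ring and its origin: the morphism phi is
    the substitution f(x) |-> f(tx), so the last hypothesis says that I is primary
    to the ideal of the origin. *)
Theorem behrend_nu_sum (R : realType) (D : idomainType) (I : idealr D)
    (phi : {rmorphism D -> {poly D}}) g :
  noetherian D -> normal_domain D -> (forall m : nat, m.+1%:R \is a @GRing.unit D) ->
  injective phi -> normal_ideal [set` I] -> g \in I -> g != 0 ->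
  (forall a, radical [set` I] a <-> (phi a)`_0 = 0) ->
  behrend_nu I R =
    \esum_(v in rees_valuation [set` I])
       er_map (fun z : int => z%:~R : R) (valuation_of_ideal [set` I] v).
Proof.
move=> noethD normD' natD phi_inj normI Ig g0 radI.
have normD := normal_domain_poly natD normD'.
have iI := idealr_is_ideal I.
have [h [h_surj kerh]] := gr_presentation normI.
have I0 a : [set` I] a -> (phi a)`_0 = 0 by move=> Ia; apply/radI; exists 1%N.
have rad0 a : (phi a)`_0 = 0 -> radical [set` I] a by move/radI.
have degree1 (Q : prime_ideal (rees_closure [set` I])) :
    minimal_prime_over (extended_ideal [set` I]) Q ->
    exists a (y : rees_closure [set` I]), [/\ [set` I] a, val y = a *: 'X & ~ prime_set Q y].
  exact: (minimal_prime_not_irrelevant normI phi_inj Ig g0 I0 rad0).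
have /choice[e eP] (P : prime_ideal (gr I)) : exists v, minimal_prime_over [set 0] P ->
    rees_valuation [set` I] v /\
    valuation_ring v = [set z | exists x s, ~ prime_set P (h s) /\
      z = rees_frac [set` I] x / rees_frac [set` I] s] /\
    ring_length (localization P) R =
      er_map (fun z : int => z%:~R : R) (valuation_of_ideal [set` I] v).
  have [minP|] := pselect (minimal_prime_over [set 0] P); last by exists (fun=> 0%E).
  have [Q QP] := preimage_prime h P.
  have minQ := (minimal_prime_preimage h_surj kerh QP).1 minP.
  have [a [y [Ia yE Qy]]] := degree1 Q minQ.
  have [v [vn vr]] := minimal_prime_valuation normI Ia yE Qy noethD normD natD iI minQ.
  exists v => _; split; first by split=> //; exists Q.
  split; first by rewrite vr /local_ring QP.
  exact: (length_eq_valuation normI Ia yE Qy vn vr _ h_surj kerh QP).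
(* The map e sends a minimal prime of gr_I(D) to its Rees valuation. *)
rewrite /behrend_nu (reindex_esum [set P | minimal_prime_over [set 0] P] _ e); last first.
  split.
  - by move=> P /eP[].
  - move=> P P' /set_mem minP /set_mem minP' ePP'.
    have [Q QP] := preimage_prime h P; have [Q' QP'] := preimage_prime h P'.
    have QQ' : prime_set Q = prime_set Q'.
      apply: (@local_ring_prime _ _ (rees_frac [set` I])); first exact: rees_frac_inj.
      have [_ [vr _]] := eP P minP; have [_ [vr' _]] := eP P' minP'.
      by rewrite /local_ring QP QP' -[LHS]vr ePP' vr'.
    apply: prime_ideal_inj; apply/seteqP; split=> x; have [x' <-] := h_surj x.
      by move=> Px; have : prime_set Q x' by [rewrite QP]; rewrite QQ' QP'.
    by move=> Px; have : prime_set Q' x' by [rewrite QP']; rewrite -QQ' QP.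
  - move=> v [vn [Q [minQ vr]]].
    have [|P QP] := image_prime h_surj (Q := Q).
      by move=> x /kerh; apply: minQ.1.
    have minP := (minimal_prime_preimage h_surj kerh QP).2 minQ.
    exists P => //; have [[en _] [er _]] := eP P minP.
    apply: normalized_valuation_inj => //; rewrite er vr /rees_closure_at.
    by rewrite QP.
by apply: eq_esum => P minP; have [_ [_ ->]] := eP P minP.
Qed.

Theorem corollary3p1 (R : realType) (n : nat) (I : idealr (mpoly n R[i])) :
  (0 < n)%N ->
  normal_ideal [set` I] ->
  zero_dimensional_ideal [set` I] ->
  primary_to [set` I] (origin_ideal n R[i]) ->
  behrend_nu I R =
    \esum_(v in rees_valuation [set` I])
       er_map (fun z : int => z%:~R : R) (valuation_of_ideal [set` I] v).
Proof.
move=> n_gt0 normI _ [[iI _ _] radI].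
have noethD : noetherian (mpoly n R[i]) by apply/noetherian_mpoly/noetherian_field.
have natD (m : nat) : m.+1%:R \is a @GRing.unit (mpoly n R[i]).
  by rewrite -(rmorph_nat (@mpolyC n R[i])) rmorph_unit // unitfE pnatr_eq0.
have [g Ig g0] : exists2 g, g \in I & g != 0.
  have : radical [set` I] (mpolyX R[i] (mnm1 (Ordinal n_gt0))).
    by rewrite radI; apply: subset_ideal_span; exists (Ordinal n_gt0).
  move=> [k Ik]; exists (mpolyX R[i] (mnm1 (Ordinal n_gt0)) ^+ k) => //.
  rewrite expf_neq0 //; apply/eqP => /(congr1 (mcoeff (mnm1 (Ordinal n_gt0)))).
  by rewrite mcoeffX eqxx mcoeff0 => /eqP; rewrite oner_eq0.
have rad0 a : radical [set` I] a <-> (grading_morph n R[i] a)`_0 = 0.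
  by rewrite radI; apply: origin_idealP.
exact: (behrend_nu_sum R noethD (@normal_domain_mpoly n _) natD
  (@grading_morph_inj n _) normI Ig g0 rad0).
Qed.
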